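(* Let $S$ be the del Pezzo surface of degree $7$. There do not exist an automorphism $g\in\operatorname{Aut}(S\times S)$ of order $7$ and a section $s\in H^0(S\times S,-K_{S\times S})$ such that $g^*s=c\,s$ for some $c\in\mathbb{C}^*$ and the zero locus of $s$ does not intersect the fixed locus of $\langle g\rangle$.
   Context: All varieties are over $\mathbb{C}$. The del Pezzo surface of degree $7$ (unique up to isomorphism) is the blow-up of $\mathbb{P}^2$ in the two points $(1:0:0)$ and $(0:1:0)$. The fixed locus of the group $\langle g\rangle$ of order $7$ is the set of points fixed by some non-identity element of $\langle g\rangle$ (equivalently, the set of fixed points of $g$). *)

(* Defs.v *)
From HB Require Import structures.
From mathcomp Require Import all_boot all_order all_algebra.
From mathcomp Require Import reals.
From mathcomp Require Import complex.
From mathcomp Require Import mpoly.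

Set Implicit Arguments.
Unset Strict Implicit.
Unset Printing Implicit Defensive.

Import GRing.Theory.
Local Open Scope ring_scope.

(* Subvarieties of products of projective spaces, classically: a set of points
   with multihomogeneous coordinates.  [fac i] names the projective factor to
   which the i-th coordinate belongs; [hcoord p] is one choice of homogeneous
   coordinates of p, so only expressions invariant under rescaling each factor
   separately are meaningful. *)
Record mpset (F : fieldType) := MPSet {
  point :> Type;
  nvars : nat;
  factor : finType;
  fac : 'I_nvars -> factor;
  hcoord : point -> 'I_nvars -> F }.

Arguments fac {F} m _ : rename.
Arguments hcoord {F} m _ _ : rename.

Section Constructions.
Variable F : fieldType.

(* P^n as the set of lines through the origin of F^(n+1). *)
Definition projsp (n : nat) : mpset F :=
  @MPSet F {L : {vspace 'rV[F]_n.+1} | \dim L == 1%N} n.+1 unit (fun=> tt)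
    (fun L i => vpick (val L) 0 i).

Definition mpprod (X Y : mpset F) : mpset F :=
  @MPSet F (X * Y)%type (nvars X + nvars Y) (factor X + factor Y)%type
    (fun i => match split i with
              | inl a => inl (fac X a) | inr b => inr (fac Y b) end)
    (fun p i => match split i with
                | inl a => hcoord X p.1 a | inr b => hcoord Y p.2 b end).

Definition mpsub (X : mpset F) (P : pred X) : mpset F :=
  @MPSet F {p : X | P p} (nvars X) (factor X) (fac X)
    (fun p => hcoord X (val p)).

(* The blow-up of P^2, with coordinates (x : y : z), in (1:0:0) and (0:1:0).
   The ideals of these points are (y, z) and (x, z), so the two blow-ups are
   { y b = z a } and { x d = z c } in P^2 x P^1, with coordinates (a : b) and
   (c : d) on P^1; the centres being disjoint, blowing up both points amounts to
   taking the fibre product of the two over P^2. *)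
Definition dP7 : mpset F :=
  @mpsub (mpprod (projsp 2) (mpprod (projsp 1) (projsp 1)))
    (fun p =>
       let: (l, (m1, m2)) := p in
       let x := hcoord (projsp 2) l 0 in
       let y := hcoord (projsp 2) l 1 in
       let z := hcoord (projsp 2) l 2 in
       let a := hcoord (projsp 1) m1 0 in
       let b := hcoord (projsp 1) m1 1 in
       let c := hcoord (projsp 1) m2 0 in
       let d := hcoord (projsp 1) m2 1 in
       (y * b == z * a) && (x * d == z * c)).

End Constructions.

Section Varieties.
Variables (F : fieldType) (X : mpset F).

Definition mhomog (d : factor X -> nat) (P : {mpoly F[nvars X]}) : Prop :=
  forall m, m \in msupp P ->
  forall j, (\sum_(i < nvars X | fac X i == j) m i)%N = d j.

(* f is given by P / Q on the Zariski neighbourhood Q <> 0 of p; the values of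
   f outside this neighbourhood are unconstrained. *)
Definition regular_at (f : X -> F) (p : X) : Prop :=
  exists (d : factor X -> nat) (P Q : {mpoly F[nvars X]}),
    [/\ mhomog d P, mhomog d Q, Q.@[hcoord X p] != 0
      & forall q, Q.@[hcoord X q] != 0 ->
          f q = P.@[hcoord X q] / Q.@[hcoord X q]].

(* Pulling back regular functions to regular functions.  Zariski continuity is
   included: apply the condition to characteristic functions of open sets. *)
Definition regular_map (g : X -> X) : Prop :=
  forall (p : X) (f : X -> F),
    regular_at f (g p) -> regular_at (fun q => f (g q)) p.

Record automorphism := Automorphism {
  aut :> X -> X;
  aut_inv : X -> X;
  autK : cancel aut aut_inv;
  aut_invK : cancel aut_inv aut;
  aut_regular : regular_map aut;
  aut_inv_regular : regular_map aut_inv }.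

Definition has_order (g : automorphism) (n : nat) : Prop :=
  [/\ (0 < n)%N, iter n g =1 id
    & forall k, (0 < k < n)%N -> ~ (iter k g =1 id)].

(* For g of finite order, every element of <g> is some g^k with k : nat. *)
Definition in_fixed_locus (g : automorphism) (p : X) : Prop :=
  exists k : nat, ~ (iter k g =1 id) /\ iter k g p = p.

(* Regular sections of the n-th exterior power of the tangent bundle, for X
   smooth.  The fibre of this bundle at p consists of the alternating n-linear
   maps on functions regular at p that are derivations at p in each argument
   (for n = 1: the tangent vectors at p).  The value of [sec p] on tuples that
   are not regular at p is irrelevant. *)
Record polyvector (n : nat) := Polyvector {
  sec :> X -> ('I_n -> X -> F) -> F;
  sec_linear : forall p (h : 'I_n -> X -> F) i (a : F) (f1 f2 : X -> F),
    (forall j, regular_at (h j) p) -> regular_at f1 p -> regular_at f2 p ->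
    sec p (dfwith h (i := i) (fun q => a * f1 q + f2 q))
    = a * sec p (dfwith h (i := i) f1) + sec p (dfwith h (i := i) f2);
  sec_leibniz : forall p (h : 'I_n -> X -> F) i (f1 f2 : X -> F),
    (forall j, regular_at (h j) p) -> regular_at f1 p -> regular_at f2 p ->
    sec p (dfwith h (i := i) (fun q => f1 q * f2 q))
    = f1 p * sec p (dfwith h (i := i) f2) + f2 p * sec p (dfwith h (i := i) f1);
  sec_alternating : forall p (h : 'I_n -> X -> F) i j,
    (forall k, regular_at (h k) p) -> i != j -> h i = h j -> sec p h = 0;
  sec_regular : forall p (h : 'I_n -> X -> F),
    (forall k, regular_at (h k) p) -> regular_at (fun q => sec q h) p }.

(* (g^* s)_p = (dg_p)^(-1) (s_(g p)), evaluated on h. *)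
Definition pullback (n : nat) (g : automorphism) (s : polyvector n)
    (p : X) (h : 'I_n -> X -> F) : F :=
  s (g p) (fun i q => h i (aut_inv g q)).

Definition semi_invariant (n : nat) (g : automorphism) (s : polyvector n)
    (c : F) : Prop :=
  forall p (h : 'I_n -> X -> F), (forall i, regular_at (h i) p) ->
    pullback g s p h = c * s p h.

Definition in_zero_locus (n : nat) (s : polyvector n) (p : X) : Prop :=
  forall h : 'I_n -> X -> F, (forall i, regular_at (h i) p) -> s p h = 0.

End Varieties.

Arguments automorphism {F} X.
Arguments polyvector {F} X n.

Definition dP7xdP7 (R : realType) : mpset R[i] := mpprod (dP7 R[i]) (dP7 R[i]).

(* S x S is smooth of dimension 4, so -K is the 4-th exterior power of the
   tangent bundle. *)
Definition anticanonical_section (R : realType) := polyvector (dP7xdP7 R) 4.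

(* Main.v *)
Require Import Defs.
From mathcomp Require Import all_boot all_order all_fingroup all_algebra.
From mathcomp Require Import reals complex.
From mathcomp Require Import mpoly boolp ring.

(* Write S for the del Pezzo surface, E_0, E_1 for its exceptional curves over
   the two centres, L for the strict transform of the line through the centres
   and q_e for the point where E_e meets L.  On X = S x S the span of the global
   vector fields is an invariant of Aut(X).  It is 0 exactly at the four points
   (q_e, q_e'), and it has rank at most 1 exactly on the twelve curves C x q_e
   and q_e x C with C among E_0, E_1, L: since these are (-1)-curves, global
   fields are tangent to them, and explicit translations and scalings generate
   the rest.  An automorphism g with g^7 = 1 permutes four points, hence fixes
   them, so a section s without zeros on the fixed locus does not vanish there.
   By adjunction -K has degree 1 on each of the twelve curves, so s has exactly
   one zero on each of them; these twelve zeros are distinct, because two of the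
   curves meet only in points (q_e, q_e'), and g permutes them.  As 7 does not
   divide 12, one of them is a fixed point of g, a contradiction. *)

Set Implicit Arguments.
Unset Strict Implicit.
Unset Printing Implicit Defensive.

Import GRing.Theory.
Local Open Scope ring_scope.

(** * Locally rational functions of one variable *)

Section OneVariable.
Variable F : closedFieldType.
Implicit Types (p q r : {poly F}) (phi : F -> F).

(** No description of Aut(S x S) enters. The four points and the twelve curves are defined by all
    global fields at once, so their invariance under g is formal; explicit fields only bound these
    loci from above, and tangency to the curves bounds them from below. Line bundles on a curve are
    handled by hand: the curve is covered by two affine arcs glued by t -> 1/t, a regular function
    on an arc is a polynomial, and p(t) = t^k q(1/t) bounds the degree of p by k. With the
    transition (tau, nu) -> (1/tau, tau nu), the normal part of a field is a section of O(-1), hence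
    0. The value of s on tau, nu and two coordinates of the other factor has degree 2 - 1 + 0 + 0 =
    1, hence the form a + b t. It is not identically 0 because each of the curves passes through a
    point (q_e, q_e'). The obstacle is the encoding: functions are total and constrained only near a
    point, and homogeneous coordinates are arbitrary choices. Locality of derivations must therefore
    be derived, and coordinates are compared only up to a rescaling of each projective factor. *)

Lemma poly_vanish_eq0 p : (forall t, p.[t] = 0) -> p = 0.
Proof.
(* The polynomial [p + 1] takes only the value 1; having no root over an algebraically closed field,
   it is constant. *)
move=> p0; have : size (p + 1) == 1.
  apply/negPn/closed_rootP => -[t]; rewrite /root hornerD p0 hornerC add0r.
  by rewrite oner_eq0.
case/size_poly1P => c _ pc; have {}pc : p = (c - 1)%:P.
  by rewrite polyCB -pc polyC1 addrK.
by have := p0 0; rewrite pc hornerC => ->; rewrite polyC0.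
Qed.

Lemma poly_eq_off_roots r p q :
  r != 0 -> (forall t, r.[t] != 0 -> p.[t] = q.[t]) -> p = q.
Proof.
move=> r0 E; apply/subr0_eq/(mulfI r0); rewrite mulr0.
apply: poly_vanish_eq0 => t; rewrite hornerM hornerD hornerN.
have [->|/E ->] := eqVneq r.[t] 0; first by rewrite mul0r.
by rewrite subrr mulr0.
Qed.

Definition locally_rational phi := forall t0, exists p q,
  q.[t0] != 0 /\ forall t, q.[t] != 0 -> phi t = p.[t] / q.[t].

Lemma horner_neq0 q t : q.[t] != 0 -> q != 0.
Proof. by apply: contra_neq => ->; rewrite horner0. Qed.

(** Regular functions on the affine line are polynomials: all local fractions represent one rational
    function, and a root of its reduced denominator would, by comparison with the local fraction at
    that root, also be a root of the reduced numerator. *)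
Lemma locally_rational_poly phi :
  locally_rational phi -> exists p, forall t, phi t = p.[t].
Proof.
move=> L; have [p [q [q0 E]]] := L 0; have {}q0 := horner_neq0 q0.
pose d := gcdp p q; have d0 : d != 0 by rewrite gcdp_eq0 (negPf q0) andbF.
pose p' := p %/ d; pose q' := q %/ d.
have pE : p = p' * d by rewrite divpK // dvdp_gcdl.
have qE : q = q' * d by rewrite divpK // dvdp_gcdr.
have cop : coprimep p' q' by apply: coprimep_div_gcd; rewrite q0 orbT.
have q'0 : q' != 0 by apply: contraNneq q0 => q'0; rewrite qE q'0 mul0r.
have cross p1 q1 : q1 != 0 ->
    (forall t, q1.[t] != 0 -> phi t = p1.[t] / q1.[t]) -> p1 * q' = p' * q1.
  move=> q10 E1; apply: (@poly_eq_off_roots (q * q1)); first by rewrite mulf_neq0.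
  move=> t; rewrite !hornerM mulf_eq0 negb_or => /andP[qt q1t].
  have := E1 _ q1t; rewrite (E _ qt) pE qE !hornerM.
  move: qt; rewrite qE hornerM mulf_eq0 negb_or => /andP[q't dt].
  rewrite -mulf_div divff // mulr1 => /eqP.
  by rewrite eqr_div // => /eqP <-.
have : size q' == 1.
  apply/negPn/closed_rootP => -[t1 /rootP rt].
  have [p1 [q1 [q1t E1]]] := L t1.
  have /(congr1 (fun r : {poly F} => r.[t1])) := cross _ _ (horner_neq0 q1t) E1.
  rewrite !hornerM rt mulr0 => /esym/eqP; rewrite mulf_eq0 (negPf q1t) orbF.
  move/eqP => p't; have := cop; rewrite /coprimep.
  have: ('X - t1%:P) %| gcdp p' q'.
    by rewrite dvdp_gcd !dvdp_XsubCl /root p't rt eqxx.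
  by move=> /[swap] /size_poly1P[c c0 ->]; rewrite dvdp_XsubCl /root hornerC (negPf c0).
case/size_poly1P => c c0 q'c; exists (c^-1 *: p') => t1.
have [p1 [q1 [q1t E1]]] := L t1; rewrite (E1 _ q1t).
have /(congr1 (fun r : {poly F} => r.[t1])) := cross _ _ (horner_neq0 q1t) E1.
rewrite q'c !hornerM hornerC hornerZ => e.
have -> : p'.[t1] = p1.[t1] * c / q1.[t1] by rewrite e mulfK.
by rewrite mulrA [c^-1 * _]mulrC mulfK.
Qed.

(** The degree bound for sections of O(k) on the projective line. Reversing the coefficients of [q]
    turns the hypothesis into the identity ['X^n * p = 'X^k * q'] of polynomials, whose sizes are
    compared. *)
Lemma size_reciprocal p q k :
  (forall t, t != 0 -> p.[t] = t ^+ k * q.[t^-1]) -> (size p <= k.+1)%N.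
Proof.
move=> E; have [->|p0] := eqVneq p 0; first by rewrite size_poly0.
(* Any bound [n] for the degree of [q] serves here; [size q] also covers [q = 0]. *)
pose n := size q; pose q' := \poly_(i < n.+1) q`_(n - i).
have q'E t : t != 0 -> q'.[t] = t ^+ n * q.[t^-1].
  move=> t0; rewrite horner_poly (@horner_coef_wide _ n.+1 q) ?leqnSn //.
  rewrite (reindex_inj rev_ord_inj) mulr_sumr /=.
  apply: eq_bigr => i _; rewrite subSS subKn; last by rewrite -ltnS ltn_ord.
  have le_in : (i <= n)%N by rewrite -ltnS ltn_ord.
  rewrite exprVn mulrCA; congr (_ * _).
  have -> : t ^+ n = t ^+ (n - i) * t ^+ i by rewrite -exprD subnK.
  by rewrite mulfK // expf_neq0.
have : 'X^n * p = 'X^k * q'.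
  apply: (@poly_eq_off_roots 'X); first by rewrite polyX_eq0.
  move=> t; rewrite hornerX => t0; rewrite !hornerM !hornerXn E // q'E //.
  by rewrite mulrCA.
move/(congr1 (fun r : {poly F} => size r)).
rewrite ![_ ^+ _ * _]mulrC size_mulXn // => e.
have : (size (q' * 'X^k)%R <= n.+1 + k)%N.
  have [->|q'0] := eqVneq q' 0; first by rewrite mul0r size_poly0.
  by rewrite size_mulXn // addnC leq_add2r size_poly.
by rewrite -e addSnnS leq_add2l.
Qed.

End OneVariable.

(** * Germs and derivations *)

Section Homogeneous.
Variables (F : fieldType) (X : mpset F).
Implicit Types (P Q : {mpoly F[nvars X]}) (d : factor X -> nat).

Lemma mhomog0 d : mhomog d (0 : {mpoly F[nvars X]}).
Proof. by move=> m; rewrite msupp0. Qed.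

Lemma mhomogC c : mhomog (fun=> 0%N) (c%:MP : {mpoly F[nvars X]}).
Proof.
move=> m; rewrite msuppC; case: eqP => // _; rewrite inE => /eqP-> j.
by rewrite big1 // => i _; rewrite mnm0E.
Qed.

Lemma mhomogX i : mhomog (fun j => (fac X i == j) : nat) ('X_i : {mpoly F[nvars X]}).
Proof.
move=> m; rewrite msuppX inE => /eqP-> j.
rewrite (eq_bigr (fun k => (i == k) : nat)) => [|k _]; last by rewrite mnm1E.
have [ij|ij] := eqVneq (fac X i) j.
  by rewrite (bigD1 i) ?ij //= eqxx big1 // => k /andP[_]; rewrite eq_sym => /negPf->.
by rewrite big1 // => k /eqP kj; case: eqP => // ik; rewrite ik kj eqxx in ij.
Qed.

Lemma mhomogD d P Q : mhomog d P -> mhomog d Q -> mhomog d (P + Q).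
Proof. by move=> hP hQ m /msuppD_le; rewrite mem_cat => /orP[/hP|/hQ]. Qed.

Lemma mhomogZ d c P : mhomog d P -> mhomog d (c *: P).
Proof. by move=> hP m /msuppZ_le/hP. Qed.

Lemma mhomogB d P Q : mhomog d P -> mhomog d Q -> mhomog d (P - Q).
Proof. by move=> hP hQ; rewrite -scaleN1r; apply/mhomogD/mhomogZ. Qed.

Lemma mhomogM d e P Q :
  mhomog d P -> mhomog e Q -> mhomog (fun j => d j + e j)%N (P * Q).
Proof.
move=> hP hQ m /msuppM_le/allpairsP[[m1 m2] /= [/hP h1 /hQ h2 ->]] j.
by rewrite -h1 -h2 -big_split; apply: eq_bigr => i _; rewrite mnmDE.
Qed.

Lemma mhomog_eq d e P : d =1 e -> mhomog d P -> mhomog e P.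
Proof. by move=> de hP m /hP h j; rewrite h de. Qed.

Lemma mhomog_deriv d P i j :
  fac X i = fac X j -> mhomog d P -> mhomog d ('X_j * P^`M(i)).
Proof.
move=> ij hP m; rewrite mcoeff_msupp mulrC => nz.
have [mj|mj] := boolP (U_(j) <= m)%MM; last first.
  case/eqP: nz; apply/eqP; rewrite mcoeff_eq0; apply: contra mj.
  by rewrite (perm_mem (msuppMX _ _)) => /mapP[m' _ ->]; apply: lem_addr.
move: nz; rewrite -[m](submK mj) addmC mcoeffMX mcoeff_deriv => nz k.
have /hP/(_ k) <- : (m - U_(j) + U_(i))%MM \in msupp P.
  by rewrite mcoeff_msupp; apply: contraNneq nz => ->; rewrite mul0rn.
rewrite !(eq_bigr _ (fun l _ => mnmDE l _ _)) !big_split /= addnC; congr addn.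
have U k' : (\sum_(l < nvars X | fac X l == k) U_(k')%MM l)%N = (fac X k' == k).
  by apply: (mhomogX (i := k')); rewrite msuppX inE.
by rewrite !U ij.
Qed.

Lemma mhomog_scale d P (lam : factor X -> F) x : mhomog d P ->
  P.@[fun i => lam (fac X i) * x i] = (\prod_j lam j ^+ d j) * P.@[x].
Proof.
move=> hP; rewrite !mevalE big_distrr /=; apply: eq_big_seq => m mP.
rewrite mulrCA; congr (_ * _).
under eq_bigr do rewrite exprMn; rewrite big_split /=; congr (_ * _).
rewrite (partition_big (fac X) predT) //=; apply: eq_bigr => j _.
rewrite -(hP _ mP) -prodrXr; apply: eq_bigr => i /eqP->; by [].
Qed.

End Homogeneous.

Section Germs.
Variables (F : fieldType) (X : mpset F).
Implicit Types (P Q : {mpoly F[nvars X]}) (d : factor X -> nat).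
Implicit Types (p q : X) (f g h : X -> F) (A B : X -> Prop).

Definition near p A := exists d Q,
  [/\ mhomog d Q, Q.@[hcoord X p] != 0 & forall q, Q.@[hcoord X q] != 0 -> A q].

Lemma near_all p A : (forall q, A q) -> near p A.
Proof.
move=> a; exists (fun=> 0%N), 1; split=> //; last by rewrite meval1 oner_neq0.
by rewrite -mpolyC1; apply: mhomogC.
Qed.

Lemma near_and p A B : near p A -> near p B -> near p (fun q => A q /\ B q).
Proof.
move=> [d [P [hP P0 PA]]] [e [Q [hQ Q0 QB]]].
exists (fun j => d j + e j)%N, (P * Q); split; first exact: mhomogM.
  by rewrite mevalM mulf_neq0.
by move=> q; rewrite mevalM mulf_eq0 negb_or => /andP[/PA ? /QB].
Qed.

Lemma near_mono p A B : (forall q, A q -> B q) -> near p A -> near p B.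
Proof.
by move=> AB [d [P [hP P0 PA]]]; exists d, P; split=> // q /PA /AB.
Qed.

Lemma near_point p A : near p A -> A p.
Proof. by case=> d [P [_ P0]]; apply. Qed.

Lemma near_coord p i : hcoord X p i != 0 -> near p (fun q => hcoord X q i != 0).
Proof.
move=> pi; exists (fun j => (fac X i == j) : nat), 'X_i; split.
- exact: mhomogX.
- by rewrite mevalXU.
- by move=> q; rewrite mevalXU.
Qed.

Lemma near_forall (I : finType) p (A : I -> X -> Prop) :
  (forall i, near p (A i)) -> near p (fun q => forall i, A i q).
Proof.
move=> nA; have : near p (fun q => forall i, i \in enum I -> A i q).
  elim: (enum I) => [|i s IH]; first by apply: near_all => q i.
  apply: near_mono (near_and (nA i) IH) => q [Ai As] j.
  by rewrite inE => /predU1P[->|/As].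
by apply: near_mono => q + i; apply; rewrite mem_enum.
Qed.

(** A fraction known only near [p] suffices: multiplying numerator and denominator by the polynomial
    that cuts out the neighbourhood makes it valid wherever the new denominator is nonzero. *)
Lemma regular_atP p f : regular_at f p <-> exists d P Q,
  [/\ mhomog d P, mhomog d Q, Q.@[hcoord X p] != 0
    & near p (fun q => Q.@[hcoord X q] != 0 /\
                       f q = P.@[hcoord X q] / Q.@[hcoord X q])].
Proof.
split=> [[d [P [Q [hP hQ Q0 E]]]]|[d [P [Q [hP hQ Q0 [e [R [hR R0 E]]]]]]]].
  exists d, P, Q; split=> //; exists d, Q; split=> // q Qq; split=> //; exact: E.
exists (fun j => d j + e j)%N, (P * R), (Q * R); split; try exact: mhomogM.
  by rewrite mevalM mulf_neq0.
move=> q; rewrite mevalM mulf_eq0 negb_or => /andP[Qq Rq].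
by have [_ ->] := E _ Rq; rewrite mevalM -mulf_div divff // mulr1.
Qed.

Lemma regular_near p f g :
  near p (fun q => f q = g q) -> regular_at g p -> regular_at f p.
Proof.
move=> fg /regular_atP[d [P [Q [hP hQ Q0 E]]]]; apply/regular_atP.
exists d, P, Q; split=> //; apply: near_mono (near_and fg E).
by move=> q [-> [? ->]].
Qed.

Lemma regular_cst p c : regular_at (fun _ : X => c) p.
Proof.
exists (fun=> 0%N), c%:MP, 1; split; first exact: mhomogC.
- by rewrite -mpolyC1; apply: mhomogC.
- by rewrite meval1 oner_neq0.
- by move=> q _; rewrite mevalC meval1 divr1.
Qed.

Lemma regularD p f g :
  regular_at f p -> regular_at g p -> regular_at (fun q => f q + g q) p.
Proof.
move=> [d [P [Q [hP hQ Q0 E]]]] [e [R [S [hR hS S0 E']]]].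
exists (fun j => d j + e j)%N, (P * S + R * Q), (Q * S); split.
- apply: mhomogD; first exact: mhomogM.
  apply: (@mhomog_eq _ _ (fun j => e j + d j)%N); last exact: mhomogM.
  by move=> j; apply: addnC.
- exact: mhomogM.
- by rewrite mevalM mulf_neq0.
move=> q; rewrite !(mevalD, mevalM) mulf_eq0 negb_or => /andP[Qq Sq].
by rewrite E // E' // addf_div.
Qed.

Lemma regularM p f g :
  regular_at f p -> regular_at g p -> regular_at (fun q => f q * g q) p.
Proof.
move=> [d [P [Q [hP hQ Q0 E]]]] [e [R [S [hR hS S0 E']]]].
exists (fun j => d j + e j)%N, (P * R), (Q * S); split; try exact: mhomogM.
- by rewrite mevalM mulf_neq0.
move=> q; rewrite !mevalM mulf_eq0 negb_or => /andP[Qq Sq].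
by rewrite E // E' // mulf_div.
Qed.

Lemma regularV p f :
  f p != 0 -> regular_at f p -> regular_at (fun q => (f q)^-1) p.
Proof.
move=> fp [d [P [Q [hP hQ Q0 E]]]].
have P0 : P.@[hcoord X p] != 0.
  by apply: contraNneq fp => P0; rewrite E // P0 mul0r.
apply/regular_atP; exists d, Q, P; split=> //.
exists (fun j => d j + d j)%N, (P * Q); split; first exact: mhomogM.
  by rewrite mevalM mulf_neq0.
move=> q; rewrite mevalM mulf_eq0 negb_or => /andP[Pq Qq]; split=> //.
by rewrite E // invf_div.
Qed.

Definition ratio (i j : 'I_(nvars X)) : X -> F :=
  fun q => hcoord X q i / hcoord X q j.

Lemma regular_ratio p i j :
  fac X i = fac X j -> hcoord X p j != 0 -> regular_at (ratio i j) p.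
Proof.
move=> ij pj; exists (fun k => (fac X j == k) : nat), 'X_i, 'X_j.
split; try exact: mhomogX.
- by rewrite -ij; apply: mhomogX.
- by rewrite mevalXU.
- by move=> q; rewrite !mevalXU.
Qed.

Lemma near_neq0 p f : regular_at f p -> f p != 0 -> near p (fun q => f q != 0).
Proof.
move=> [d [P [Q [hP hQ Q0 E]]]] fp.
exists (fun j => d j + d j)%N, (P * Q); split; first exact: mhomogM.
  rewrite mevalM mulf_neq0 //; apply: contraNneq fp => P0.
  by rewrite E // P0 mul0r.
move=> q; rewrite mevalM mulf_eq0 negb_or => /andP[Pq Qq].
by rewrite E // mulf_neq0 // invr_eq0.
Qed.

Definition derivation_at p (D : (X -> F) -> F) :=
  (forall a f g, regular_at f p -> regular_at g p ->
     D (fun q => a * f q + g q) = a * D f + D g) /\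
  (forall f g, regular_at f p -> regular_at g p ->
     D (fun q => f q * g q) = f p * D g + g p * D f).

Section Derivation.
Variables (p : X) (D : (X -> F) -> F).
Hypothesis dD : derivation_at p D.

Lemma derivationM f g : regular_at f p -> regular_at g p ->
  D (fun q => f q * g q) = f p * D g + g p * D f.
Proof. exact: dD.2. Qed.

Lemma derivation_cst c : D (fun=> c) = 0.
Proof.
have r c' := regular_cst p c'.
have d1 : D (fun=> 1) = 0.
  have := derivationM (r 1) (r 1); rewrite (_ : (fun _ : X => 1 * 1) = (fun=> 1)).
    by rewrite !mul1r => /eqP; rewrite -subr_eq0 opprD addNKr oppr_eq0 => /eqP.
  by apply/funext => q; rewrite mulr1.
have d0 : D (fun=> 0) = 0.
  have := dD.1 (- 1) _ _ (r 1) (r 1).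
  rewrite (_ : (fun _ : X => - 1 * 1 + 1) = (fun=> 0)); last first.
    by apply/funext => q; rewrite mulr1 addNr.
  by rewrite d1 mulr0 addr0.
have := dD.1 c _ _ (r 1) (r 0).
rewrite (_ : (fun _ : X => c * 1 + 0) = (fun=> c)); last first.
  by apply/funext => q; rewrite mulr1 addr0.
by rewrite d1 d0 mulr0 addr0.
Qed.

Lemma derivationD f g : regular_at f p -> regular_at g p ->
  D (fun q => f q + g q) = D f + D g.
Proof.
move=> rf rg; rewrite -[D f]mul1r -dD.1 //; congr D.
by apply/funext => q; rewrite mul1r.
Qed.

(* Multiply by the idempotent characteristic function of a neighbourhood. *)
Lemma derivation_near f g : regular_at f p -> regular_at g p ->
  near p (fun q => f q = g q) -> D f = D g.
Proof.
move=> rf rg [d [Q [hQ Q0 E]]].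
pose chi (q : X) : F := (Q.@[hcoord X q] != 0)%:R.
have rchi : regular_at chi p.
  by exists d, Q, Q; split=> // q Qq; rewrite /chi Qq divff.
have chip : chi p = 1 by rewrite /chi Q0.
have Dchi : D chi = 0.
  have := derivationM rchi rchi; rewrite (_ : (fun q => chi q * chi q) = chi).
    by rewrite chip !mul1r => /eqP; rewrite -subr_eq0 opprD addNKr oppr_eq0 => /eqP.
  by apply/funext => q; rewrite /chi; case: eqP; rewrite ?mulr0 ?mulr1.
have l h : regular_at h p -> D h = D (fun q => chi q * h q).
  by move=> rh; rewrite derivationM // chip Dchi mul1r mulr0 addr0.
rewrite l // [RHS]l //; congr D; apply/funext => q; rewrite /chi.
by have [|/E->] := eqVneq; rewrite ?mul0r.
Qed.

Lemma derivationV f : regular_at f p -> f p != 0 ->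
  D (fun q => (f q)^-1) = - (f p)^-2 * D f.
Proof.
move=> rf fp; have rV := regularV fp rf.
have : D (fun q => f q * (f q)^-1) = 0.
  rewrite -(derivation_cst 1); apply: derivation_near; first exact: regularM.
    exact: regular_cst.
  by apply: near_mono (near_neq0 rf fp) => q fq; rewrite divff.
rewrite derivationM // => /eqP; rewrite addr_eq0 => /eqP e.
apply: (mulfI fp); rewrite e; field; exact: fp.
Qed.

End Derivation.

(* [f] is regular at [p] and [df] is a combination of the [dx_k] at [p]. *)
Definition spanned (I : finType) p (x : I -> X -> F) f :=
  regular_at f p /\ exists c : I -> F,
    forall D, derivation_at p D -> D f = \sum_k c k * D (x k).

Section Spanned.
Variables (I : finType) (p : X) (x : I -> X -> F).
Hypothesis rx : forall k, regular_at (x k) p.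

Lemma spanned_gen k : spanned p x (x k).
Proof.
split=> //; exists (fun l => (k == l)%:R) => D _.
rewrite (bigD1 k) //= eqxx mul1r big1 ?addr0 // => l.
by rewrite eq_sym => /negPf->; rewrite mul0r.
Qed.

Lemma spanned_cst a : spanned p x (fun=> a).
Proof.
split; first exact: regular_cst.
exists (fun=> 0) => D dD; rewrite (derivation_cst dD) big1 // => k _.
by rewrite mul0r.
Qed.

Lemma spannedD f g :
  spanned p x f -> spanned p x g -> spanned p x (fun q => f q + g q).
Proof.
move=> [rf [c cE]] [rg [c' cE']]; split; first exact: regularD.
exists (fun k => c k + c' k) => D dD; rewrite (derivationD dD) // cE // cE' //.
by rewrite -big_split; apply: eq_bigr => k _; rewrite mulrDl.
Qed.

Lemma spannedM f g :
  spanned p x f -> spanned p x g -> spanned p x (fun q => f q * g q).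
Proof.
move=> [rf [c cE]] [rg [c' cE']]; split; first exact: regularM.
exists (fun k => f p * c' k + g p * c k) => D dD.
rewrite (derivationM dD) // cE // cE' // !mulr_sumr -big_split.
by apply: eq_bigr => k _; rewrite mulrDl !mulrA.
Qed.

Lemma spannedV f : f p != 0 ->
  spanned p x f -> spanned p x (fun q => (f q)^-1).
Proof.
move=> fp [rf [c cE]]; split; first exact: regularV.
exists (fun k => - (f p)^-2 * c k) => D dD; rewrite (derivationV dD) // cE //.
by rewrite mulr_sumr; apply: eq_bigr => k _; rewrite mulrA.
Qed.

Lemma spanned_near f g :
  near p (fun q => f q = g q) -> spanned p x g -> spanned p x f.
Proof.
move=> fg [rg [c cE]]; have rf := regular_near fg rg; split=> //.
by exists c => D dD; rewrite (derivation_near dD rf rg fg) cE.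
Qed.

Lemma spanned_meval (u : 'I_(nvars X) -> X -> F) P :
  (forall i, spanned p x (u i)) -> spanned p x (fun q => P.@[fun i => u i q]).
Proof.
move=> su.
have prodP (s : seq 'I_(nvars X)) (m : 'X_{1..nvars X}) :
    spanned p x (fun q => \prod_(i <- s) u i q ^+ m i).
  elim: s => [|i s IH].
    rewrite (_ : (fun _ => _) = (fun=> 1)); first exact: spanned_cst.
    by apply/funext => q; rewrite big_nil.
  rewrite (_ : (fun _ => _) = (fun q => u i q ^+ m i * \prod_(j <- s) u j q ^+ m j)).
    apply: spannedM => //; elim: (m i) => [|k IHk]; first exact: spanned_cst.
    rewrite (_ : (fun _ => _) = (fun q => u i q * u i q ^+ k)); first exact: spannedM.
    by apply/funext => q; rewrite exprS.
  by apply/funext => q; rewrite big_cons.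
rewrite (_ : (fun _ => _) = (fun q => \sum_(m <- msupp P) P@_m * \prod_i u i q ^+ m i)).
  elim: (msupp P : seq _) => [|m s IH].
    rewrite (_ : (fun _ => _) = (fun=> 0)); first exact: spanned_cst.
    by apply/funext => q; rewrite big_nil.
  rewrite (_ : (fun _ => _) = (fun q => P@_m * \prod_i u i q ^+ m i +
     \sum_(m <- s) P@_m * \prod_i u i q ^+ m i)).
    apply: spannedD => //; apply: spannedM; first exact: spanned_cst.
    by rewrite /index_enum.
  by apply/funext => q; rewrite big_cons.
by apply/funext => q; rewrite mevalE.
Qed.

(* Dehomogenisation: on the chart where the coordinates [ref j] do not vanish,
   every regular function is a quotient of polynomials in the ratios. *)
Lemma spanned_chart (ref : factor X -> 'I_(nvars X)) :
  (forall j, fac X (ref j) = j) -> (forall j, hcoord X p (ref j) != 0) ->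
  (forall i, spanned p x (ratio i (ref (fac X i)))) ->
  forall f, regular_at f p -> spanned p x f.
Proof.
move=> refK ref0 su f [d [P [Q [hP hQ Q0 E]]]].
pose u i := ratio i (ref (fac X i)).
have nref : near p (fun q => forall j, hcoord X q (ref j) != 0).
  by apply: near_forall => j; apply: near_coord.
have evE R q : mhomog d R -> (forall j, hcoord X q (ref j) != 0) ->
    R.@[hcoord X q] = (\prod_j hcoord X q (ref j) ^+ d j) * R.@[fun i => u i q].
  move=> hR q0; rewrite -(mhomog_scale (fun j => hcoord X q (ref j))) //.
  by apply: meval_eq => i; rewrite mulrC divfK.
have Lq q : (forall j, hcoord X q (ref j) != 0) ->
    \prod_j hcoord X q (ref j) ^+ d j != 0.
  by move=> q0; apply/prodf_neq0 => j _; rewrite expf_neq0.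
have nQ : near p (fun q => Q.@[hcoord X q] != 0) by exists d, Q; split.
apply: (@spanned_near _ (fun q => P.@[fun i => u i q] * (Q.@[fun i => u i q])^-1)).
  apply: near_mono (near_and nref nQ) => q [q0 Qq].
  by rewrite E // !evE // -mulf_div divff ?mul1r // Lq.
apply: spannedM; first exact: spanned_meval.
apply: spannedV; last exact: spanned_meval.
by apply: contraNneq Q0 => u0; rewrite evE // u0 mulr0.
Qed.

End Spanned.
End Germs.

(** * Polyvectors and (-1)-curves *)

Section Polyvectors.
Variables (F : fieldType) (X : mpset F) (n : nat) (s : polyvector X n) (p : X).
Implicit Types (h x : 'I_n -> X -> F) (f g : X -> F).

Lemma dfwith_nondep (I : eqType) T (h : I -> T) i u :
  dfwith h (i := i) u = fun k => if k == i then u else h k.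
Proof.
apply/funext => k; have [->|ki] := eqVneq k i; first by rewrite dfwith_in.
by rewrite dfwith_out // eq_sym.
Qed.

Lemma dfwith_id (I : eqType) T (h : I -> T) i : dfwith h (i := i) (h i) = h.
Proof. by rewrite dfwith_nondep; apply/funext => k; case: eqP => // ->. Qed.

Lemma slot_derivation h i : (forall j, regular_at (h j) p) ->
  derivation_at p (fun f => s p (dfwith h (i := i) f)).
Proof.
move=> rh; split=> [a f g rf rg|f g rf rg]; first exact: sec_linear.
exact: sec_leibniz.
Qed.

Lemma regular_dfwith h i f : (forall j, regular_at (h j) p) ->
  regular_at f p -> forall j, regular_at (dfwith h (i := i) f j) p.
Proof. by move=> rh rf j; rewrite dfwith_nondep; case: eqP. Qed.

(** Polarisation: the form in slots [i] and [j] vanishes on equal arguments, so expanding it on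
    [h i + h j] twice gives antisymmetry. *)
Lemma sec_tperm h i j : (forall k, regular_at (h k) p) -> i != j ->
  s p (fun k => h (tperm i j k)) = - s p h.
Proof.
move=> rh ij; pose B f g := s p (dfwith (dfwith h (i := i) f) (i := j) g).
have BE f g : B f g = s p (dfwith (dfwith h (i := j) g) (i := i) f).
  rewrite /B !dfwith_nondep; congr (s p _); apply/funext => k.
  have [->|//] := eqVneq k j.
  by rewrite eq_sym (negPf ij).
have BDr f g g' : regular_at f p -> regular_at g p -> regular_at g' p ->
    B f (fun q => g q + g' q) = B f g + B f g'.
  move=> rf rg rg'; have dB : derivation_at p (B f) by apply/slot_derivation/regular_dfwith.
  exact: (derivationD dB).
have BDl f f' g : regular_at f p -> regular_at f' p -> regular_at g p ->
    B (fun q => f q + f' q) g = B f g + B f' g.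
  move=> rf rf' rg; rewrite !BE.
  have dB := slot_derivation i (@regular_dfwith h j g rh rg).
  exact: (derivationD dB).
have B0 f : regular_at f p -> B f f = 0.
  move=> rf; apply: (@sec_alternating _ _ _ _ _ _ i j) => //.
    by do 2![apply: regular_dfwith => //].
  by rewrite !dfwith_nondep (negPf ij) !eqxx.
have rS : regular_at (fun q => h i q + h j q) p by apply: regularD.
have := B0 _ rS; rewrite BDr // !BDl // !B0 // add0r addr0 => /eqP.
rewrite addr_eq0 => /eqP e.
rewrite (_ : s p h = B (h i) (h j)); last first.
  rewrite /B !dfwith_nondep; congr (s p _); apply/funext => k.
  by case: eqP => [->|_] //; case: eqP => [->|].
rewrite -[RHS]opprK -e /B !dfwith_nondep ?opprK; congr (s p _).
apply/funext => k; have [->|kj] := eqVneq k j; first by rewrite tpermR.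
have [->|ki] := eqVneq k i; first by rewrite tpermL.
by rewrite tpermD // eq_sym.
Qed.

Lemma sec_perm_eq0 x (sg : 'S_n) : (forall k, regular_at (x k) p) ->
  s p x = 0 -> s p (fun k => x (sg k)) = 0.
Proof.
move=> rx x0; have [ts -> dts] := prod_tpermP sg.
elim: ts dts => [_|[i j] ts IH /= /andP[ij /IH {}IH]].
  rewrite big_nil (_ : (fun _ => _) = x) //.
  by apply/funext => k; rewrite perm1.
rewrite big_cons /=.
pose y l := x ((\prod_(t <- ts) tperm t.1 t.2)%g l).
rewrite (_ : (fun _ => _) = fun k => y (tperm i j k)).
  by rewrite sec_tperm ?IH ?oppr0 // /y.
by apply/funext => k; rewrite permM.
Qed.

(** An alternating form of top degree is determined by its value on one tuple whose differentials
    span the cotangent space. *)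
Lemma in_zero_locus_spanned x : (forall f, regular_at f p -> spanned p x f) ->
  (forall k, regular_at (x k) p) -> s p x = 0 -> in_zero_locus s p.
Proof.
move=> sx rx x0.
(* The slots are expanded one at a time: those of index at least [k] already contain some [x j]. For
   [k = n] this is no condition; for [k = 0] the arguments either repeat or are a permutation of
   [x]. *)
suff C k h : (forall j, regular_at (h j) p) ->
    (forall i : 'I_n, (k <= i)%N -> exists j, h i = x j) -> s p h = 0.
  by move=> h rh; apply: (C n) => // i; rewrite leqNgt ltn_ord.
elim: k h => [|k IH] h rh hk.
  have [f hf] := choice (fun i => hk i (leq0n i)).
  have [finj|ninj] := injectiveP f.
    rewrite (_ : h = fun k => x (perm finj k)).
      exact: sec_perm_eq0.
    by apply/funext => i; rewrite permE hf.
  have [i [j [ij fij]]] : exists i j, i != j /\ f i = f j.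
    by move/injectivePn: (introF (injectiveP f) ninj) => [i [j ij fij]]; exists i, j.
  by apply: (@sec_alternating _ _ _ s _ _ i j); rewrite ?hf ?fij.
have [lt_kn|le_nk] := ltnP k n; last first.
  apply: IH => // i ki.
  by have := leq_ltn_trans (leq_trans le_nk ki) (ltn_ord i); rewrite ltnn.
pose i := Ordinal lt_kn.
have [_ [c cE]] := sx _ (rh i).
rewrite -[h](dfwith_id h i) (cE _ (slot_derivation i rh)) big1 // => l _.
rewrite IH ?mulr0 //; first exact: regular_dfwith.
move=> i' ki'; rewrite dfwith_nondep.
have [_|ne] := eqVneq i' i; first by exists l.
apply: hk; rewrite ltn_neqAle ki' andbT; apply: contraNneq ne => e.
by apply/eqP/val_inj.
Qed.

End Polyvectors.

(** * Affine arcs and projective lines with normal direction O(-1) *)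

Section Arcs.
Variables (F : closedFieldType) (X : mpset F).
Implicit Types (ga : F -> X) (f : X -> F) (v : X -> (X -> F) -> F).

(** The factors [lam] may depend on [t] in any way, since [hcoord] chooses homogeneous coordinates
    of each point without regard to the others. *)
Definition algebraic_arc ga := exists G : 'I_(nvars X) -> {poly F},
  forall t, exists lam : factor X -> F, (forall j, lam j != 0) /\
    forall i, hcoord X (ga t) i = lam (fac X i) * (G i).[t].

Lemma horner_mmap n (G : 'I_n -> {poly F}) (P : {mpoly F[n]}) t :
  (mmap polyC G P).[t] = P.@[fun i => (G i).[t]].
Proof.
rewrite /mmap mevalE horner_sum; apply: eq_bigr => m _.
rewrite hornerM hornerC /mmap1 horner_prod; congr (_ * _).
by apply: eq_bigr => i _; rewrite horner_exp.
Qed.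

(** In a fraction of the same multidegree the rescaling factors cancel, so the restriction to the
    arc is locally rational in [t], hence polynomial. *)
Lemma regular_on_arc ga f : algebraic_arc ga ->
  (forall t, regular_at f (ga t)) -> exists p : {poly F}, forall t, f (ga t) = p.[t].
Proof.
move=> [G GE] rf; apply: (locally_rational_poly (phi := fun t => f (ga t))).
pose R := mmap polyC G.
have L d (P : {mpoly F[nvars X]}) lam t : mhomog d P ->
    (forall i, hcoord X (ga t) i = lam (fac X i) * (G i).[t]) ->
    P.@[hcoord X (ga t)] = (\prod_j lam j ^+ d j) * (R P).[t].
  move=> hP e; rewrite horner_mmap -mhomog_scale //; exact: meval_eq.
move=> t0; have [d [P [Q [hP hQ Q0 E]]]] := rf t0.
exists (R P), (R Q); split.
  have [lam [lam0 e]] := GE t0; apply: contraNneq Q0 => r0.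
  by rewrite (L d Q lam) // r0 mulr0.
move=> t Qt; have [lam [lam0 e]] := GE t.
have l0 : \prod_j lam j ^+ d j != 0.
  by apply/prodf_neq0 => j _; rewrite expf_neq0.
by rewrite E !(L d _ lam) // ?mulf_neq0 // -mulf_div divff // mul1r.
Qed.

Definition vector_field v :=
  (forall p, derivation_at p (v p)) /\
  (forall p f, regular_at f p -> regular_at (fun q => v q f) p).

(* A projective line in [X], covered by two affine arcs, with a coordinate [tau]
   and a normal coordinate [nu] near each arc; the transition
   [(tau, nu) -> (1/tau, tau * nu)] says that, in the direction of [nu], the
   normal bundle is O(-1). *)
Record minus_one_line (ga1 ga2 : F -> X) (tau1 nu1 tau2 nu2 : X -> F) : Prop := {
  line_arc1 : algebraic_arc ga1;
  line_arc2 : algebraic_arc ga2;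
  line_glue : forall t, t != 0 -> ga1 t = ga2 t^-1;
  line_tau1 : forall t, regular_at tau1 (ga1 t);
  line_nu1 : forall t, regular_at nu1 (ga1 t);
  line_tau2 : forall t, regular_at tau2 (ga2 t);
  line_nu2 : forall t, regular_at nu2 (ga2 t);
  line_tau1E : forall t, tau1 (ga1 t) = t;
  line_nu1_eq0 : forall t, nu1 (ga1 t) = 0;
  line_tau_glue : forall t, t != 0 -> near (ga1 t) (fun q => tau2 q = (tau1 q)^-1);
  line_nu_glue : forall t, t != 0 -> near (ga1 t) (fun q => nu2 q = tau1 q * nu1 q) }.

Section Line.
Variables (ga1 ga2 : F -> X) (tau1 nu1 tau2 nu2 : X -> F).
Hypothesis ell : minus_one_line ga1 ga2 tau1 nu1 tau2 nu2.

(** In the Leibniz rule for [tau1 * nu1] the term with [D tau1] dies, because [nu1] vanishes on the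
    line. *)
Lemma line_deriv_nu t D : t != 0 -> derivation_at (ga1 t) D ->
  D nu2 = t * D nu1.
Proof.
move=> t0 dD; have r1 := line_tau1 ell t; have r2 := line_nu1 ell t.
rewrite (derivation_near dD _ (regularM r1 r2) (line_nu_glue ell t0)).
  by rewrite (derivationM dD) // (line_nu1_eq0 ell) mul0r addr0 (line_tau1E ell).
by apply: regular_near (line_nu_glue ell t0) _; apply: regularM.
Qed.

Lemma line_deriv_tau t D : t != 0 -> derivation_at (ga1 t) D ->
  D tau2 = - t^-2 * D tau1.
Proof.
move=> t0 dD; have r1 := line_tau1 ell t.
have n0 : tau1 (ga1 t) != 0 by rewrite (line_tau1E ell).
have rV := regularV n0 r1.
rewrite (derivation_near dD _ rV (line_tau_glue ell t0)).
  by rewrite (derivationV dD) // (line_tau1E ell).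
exact: regular_near (line_tau_glue ell t0) _.
Qed.

Lemma line_tangent v : vector_field v ->
  forall t, v (ga1 t) nu1 = 0 /\ v (ga2 t) nu2 = 0.
Proof.
move=> [dv rv].
have [p1 E1] := regular_on_arc (line_arc1 ell) (fun t => rv _ _ (line_nu1 ell t)).
have [p2 E2] := regular_on_arc (line_arc2 ell) (fun t => rv _ _ (line_nu2 ell t)).
have G t : t != 0 -> p2.[t^-1] = t * p1.[t].
  by move=> t0; rewrite -E2 -(line_glue ell) // -E1; apply: line_deriv_nu.
(* From [t * p1.[t] = p2.[t^-1]] with exponent 0, ['X * p1] has degree at most 0, which forces
   [p1 = 0]. *)
have s1 : (size ('X * p1)%R <= 1)%N.
  apply: (@size_reciprocal _ _ p2 0) => t t0.
  by rewrite hornerM hornerX expr0 mul1r G.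
have p10 : p1 = 0.
  apply/eqP; apply: contraTT s1 => nz.
  by rewrite mulrC size_mulX // ltnS leqn0 size_poly_eq0.
have p20 : p2 = 0.
  apply: (@poly_eq_off_roots _ 'X); first by rewrite polyX_eq0.
  move=> t; rewrite hornerX => t0.
  by have := G t^-1; rewrite invrK invr_eq0 => /(_ t0) ->; rewrite p10 !horner0 mulr0.
by move=> t; rewrite E1 E2 p10 p20 horner0.
Qed.

Definition quadruple (f0 f1 f2 f3 : X -> F) : 'I_4 -> X -> F :=
  fun i => nth f0 [:: f0; f1; f2; f3] i.

Lemma quadruple_forall (A : (X -> F) -> Prop) f0 f1 f2 f3 :
  A f0 -> A f1 -> A f2 -> A f3 -> forall i, A (quadruple f0 f1 f2 f3 i).
Proof. by move=> a0 a1 a2 a3 [[|[|[|[|]]]]]. Qed.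

Lemma quadruple_slot0 f0 f1 f2 f3 f :
  dfwith (quadruple f0 f1 f2 f3) (i := ord0) f = quadruple f f1 f2 f3.
Proof. by rewrite dfwith_nondep; apply/funext => -[[|[|[|[|]]]]]. Qed.

Lemma quadruple_slot1 f0 f1 f2 f3 f :
  dfwith (quadruple f0 f1 f2 f3) (i := lift ord0 ord0) f = quadruple f0 f f2 f3.
Proof. by rewrite dfwith_nondep; apply/funext => -[[|[|[|[|]]]]]. Qed.

(* A section of the anticanonical bundle restricts to a section of O(1). *)
Lemma line_anticanonical (s : polyvector X 4) f g :
  (forall t, regular_at f (ga1 t) /\ regular_at f (ga2 t)) ->
  (forall t, regular_at g (ga1 t) /\ regular_at g (ga2 t)) ->
  exists a b, forall t, s (ga1 t) (quadruple tau1 nu1 f g) = a + b * t /\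
                        s (ga2 t) (quadruple tau2 nu2 f g) = - (a * t + b).
Proof.
move=> rf rg.
have r1 t : forall i, regular_at (quadruple tau1 nu1 f g i) (ga1 t).
  by apply: (quadruple_forall (A := fun h => regular_at h (ga1 t)));
    [exact: (line_tau1 ell t)|exact: (line_nu1 ell t)|exact: (rf t).1|exact: (rg t).1].
have r2 t : forall i, regular_at (quadruple tau2 nu2 f g i) (ga2 t).
  by apply: (quadruple_forall (A := fun h => regular_at h (ga2 t)));
    [exact: (line_tau2 ell t)|exact: (line_nu2 ell t)|exact: (rf t).2|exact: (rg t).2].
have [p1 E1] := regular_on_arc (line_arc1 ell) (fun t => sec_regular s (r1 t)).
have [p2 E2] := regular_on_arc (line_arc2 ell) (fun t => sec_regular s (r2 t)).
(* The slot of [tau] contributes - t^-2 and that of [nu] contributes t, while [f] and [g] are common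
   to both arcs. Only one slot is changed at a time, whence the mixed tuple with [tau1] and
   [nu2]. *)
have G t : t != 0 -> p2.[t^-1] = - t^-1 * p1.[t].
  move=> t0; rewrite -E2 -E1 -(line_glue ell) //.
  have r2' := r2 t^-1; rewrite -(line_glue ell) // in r2'.
  have d0 := slot_derivation s ord0 r2'.
  have r12 : forall i, regular_at (quadruple tau1 nu2 f g i) (ga1 t).
    apply: (quadruple_forall (A := fun h => regular_at h (ga1 t))).
    - exact: (line_tau1 ell t).
    - exact: (r2' (lift ord0 ord0)).
    - exact: (rf t).1.
    - exact: (rg t).1.
  have d1 := slot_derivation s (lift ord0 ord0) r12.
  have := line_deriv_tau t0 d0; rewrite !quadruple_slot0 => ->.
  have := line_deriv_nu t0 d1; rewrite !quadruple_slot1 => ->.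
  by field.
have s1 : (size p1 <= 2)%N.
  apply: (@size_reciprocal _ _ (- p2) 1) => t t0.
  by rewrite hornerN G // expr1; field.
exists p1`_0, p1`_1.
have p1E t : p1.[t] = p1`_0 + p1`_1 * t.
  by rewrite (horner_coef_wide _ s1) big_ord_recl big_ord1 /= expr0 mulr1 expr1.
have p2E : p2 = - (p1`_0 *: 'X + (p1`_1)%:P).
  apply: (@poly_eq_off_roots _ 'X); first by rewrite polyX_eq0.
  move=> t; rewrite hornerX => t0.
  have := G t^-1; rewrite invrK invr_eq0 => /(_ t0) ->.
  by rewrite p1E !hornerE; field.
by move=> t; rewrite E1 E2 p1E p2E !hornerE.
Qed.

End Line.
End Arcs.

(** * Linear vector fields *)

(* The vector field [sum_((i, j) in A) X_j d/dX_i] on the ambient affine space. *)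
Section LinearField.
Variables (F : closedFieldType) (X : mpset F).
Variable A : seq ('I_(nvars X) * 'I_(nvars X)).
Implicit Types (P Q : {mpoly F[nvars X]}) (f g : X -> F) (p q : X).

Definition lin_deriv P := \sum_(a <- A) 'X_(a.2) * P^`M(a.1).

Definition lin_vec (x : 'I_(nvars X) -> F) i :=
  \sum_(a <- A) (a.1 == i)%:R * x a.2.

Lemma lin_derivD P Q : lin_deriv (P + Q) = lin_deriv P + lin_deriv Q.
Proof.
by rewrite /lin_deriv -big_split; apply: eq_bigr => a _; rewrite mderivD mulrDr.
Qed.

Lemma lin_derivN P : lin_deriv (- P) = - lin_deriv P.
Proof.
by rewrite /lin_deriv -sumrN; apply: eq_bigr => a _; rewrite mderivN mulrN.
Qed.

Lemma lin_derivM P Q :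
  lin_deriv (P * Q) = lin_deriv P * Q + P * lin_deriv Q.
Proof.
rewrite /lin_deriv mulr_suml mulr_sumr -big_split; apply: eq_bigr => a _.
by rewrite mderivM mulrDr; congr (_ + _); [apply: mulrA|apply: mulrCA].
Qed.

Lemma lin_derivC c : lin_deriv c%:MP = 0.
Proof. by rewrite /lin_deriv big1 // => a _; rewrite mderivC mulr0. Qed.

Lemma lin_derivX x i : (lin_deriv 'X_i).@[x] = lin_vec x i.
Proof.
rewrite /lin_deriv raddf_sum; apply: eq_bigr => a _ /=.
rewrite mevalM mevalXU mderivX mevalZ mulrC mnm1E eq_sym; congr (_ * _).
have [->|_] := eqVneq; last by rewrite mul0r.
rewrite mul1r (_ : (U_(i) - U_(i))%MM = 0%MM) ?mpolyX0 ?meval1 //.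
by apply/mnmP => k; rewrite mnmBE subnn mnm0E.
Qed.

(** The chain rule at t = 0 along the straight line [x + t * lin_vec x]. The property is stable
    under sums and products, so it is checked on constants and variables. *)
Lemma lin_deriv_flow x P :
  (mmap polyC (fun i => (x i)%:P + lin_vec x i *: 'X) P)^`().[0] =
  (lin_deriv P).@[x].
Proof.
set G := fun i => _; pose K P := (mmap polyC G P)^`().[0] = (lin_deriv P).@[x].
have RM P1 P2 : mmap polyC G (P1 * P2) = mmap polyC G P1 * mmap polyC G P2.
  apply: (@poly_eq_off_roots _ 1) => [|t _]; first exact: oner_neq0.
  by rewrite hornerM !horner_mmap mevalM.
have R0 P1 : (mmap polyC G P1).[0] = P1.@[x].
  by rewrite horner_mmap; apply: meval_eq => i; rewrite !hornerE.
have KM P1 P2 : K P1 -> K P2 -> K (P1 * P2).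
  move=> k1 k2; rewrite /K RM derivM hornerD !hornerM k1 k2 !R0.
  by rewrite lin_derivM mevalD !mevalM.
have KC c : K c%:MP by rewrite /K lin_derivC mmapC derivC horner0 meval0.
have KX i : K 'X_i.
  rewrite /K lin_derivX mmapX mmap1U derivD derivC derivZ derivX.
  by rewrite !hornerE.
have KD P1 P2 : K P1 -> K P2 -> K (P1 + P2).
  by move=> k1 k2; rewrite /K mmapD derivD hornerD k1 k2 lin_derivD mevalD.
have K1 : K 1 by rewrite -mpolyC1; apply: KC.
rewrite -/(K P) [P]mpolyE; apply: (big_ind K); [|exact: KD|move=> m _].
  by rewrite -mpolyC0; apply: KC.
rewrite -mul_mpolyC; apply: (KM) => //; rewrite mpolyXE_id.
apply: (big_ind K); [exact: K1|exact: KM|move=> i _].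
by elim: (m i) => [|k IH]; rewrite ?expr0 // exprS; apply: KM.
Qed.

Hypothesis facA : forall a, a \in A -> fac X a.1 = fac X a.2.

Lemma mhomog_lin_deriv d P : mhomog d P -> mhomog d (lin_deriv P).
Proof.
rewrite /lin_deriv => hP; rewrite big_seq; apply: (big_ind (mhomog d)); [| |move=> a aA].
- exact: mhomog0.
- exact: mhomogD.
- exact/mhomog_deriv/hP/facA.
Qed.

(** A straight line, to first order the flow of the field, replaces the exponential: off the roots
    of [r] it has to stay on the multicone over X. *)
Hypothesis flow : forall p, exists r : {poly F}, r.[0] != 0 /\
  forall t, r.[t] != 0 -> exists q (lam : factor X -> F),
    (forall j, lam j != 0) /\
    forall i, hcoord X q i =
      lam (fac X i) * (hcoord X p i + t * lin_vec (hcoord X p) i).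

(* The flow of the field stays in [X], so the field is tangent to [X]. *)
Lemma lin_deriv_tangent p d P : mhomog d P ->
  near p (fun q => P.@[hcoord X q] = 0) -> (lin_deriv P).@[hcoord X p] = 0.
Proof.
move=> hP [e [Q [hQ Q0 PQ]]]; rewrite -lin_deriv_flow.
set G := fun i => _; have [r [r0 Er]] := flow p.
suff -> : mmap polyC G P = 0 by rewrite deriv0 horner0.
have GE t i : (G i).[t] = hcoord X p i + t * lin_vec (hcoord X p) i.
  by rewrite !hornerE mulrC.
apply: (@poly_eq_off_roots _ (r * mmap polyC G Q)).
  apply: (@horner_neq0 _ _ 0); rewrite hornerM mulf_neq0 // horner_mmap.
  by rewrite (@meval_eq _ _ _ (hcoord X p)) // => i; rewrite GE mul0r addr0.
move=> t; rewrite hornerM mulf_eq0 negb_or => /andP[/Er[q [lam [lam0 qE]]] Qt].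
have L d' (P' : {mpoly F[nvars X]}) : mhomog d' P' ->
    P'.@[hcoord X q] = (\prod_j lam j ^+ d' j) * (mmap polyC G P').[t].
  move=> hP'; rewrite horner_mmap -mhomog_scale //.
  by apply: meval_eq => i; rewrite GE.
have l0 d' : \prod_j lam j ^+ d' j != 0.
  by apply/prodf_neq0 => j _; rewrite expf_neq0.
have /PQ : Q.@[hcoord X q] != 0 by rewrite (L e) // mulf_neq0.
by rewrite (L d) // horner0 => /eqP; rewrite mulf_eq0 (negPf (l0 d)) => /eqP.
Qed.

Definition quot_deriv p P Q :=
  ((lin_deriv P).@[hcoord X p] * Q.@[hcoord X p] -
   P.@[hcoord X p] * (lin_deriv Q).@[hcoord X p]) / Q.@[hcoord X p] ^+ 2.

Definition lin_field_spec p f (y : F) := exists d P Q,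
  [/\ mhomog d P, mhomog d Q, Q.@[hcoord X p] != 0,
      near p (fun q => f q = P.@[hcoord X q] / Q.@[hcoord X q])
    & y = quot_deriv p P Q].

(** Two fractions P/Q and R/S for the same germ give [P * S - R * Q] vanishing near [p]. By tangency
    its derivative vanishes at [p] too, and this is the equality of the two quotient rules. *)
Lemma lin_field_spec_uniq p f y z :
  lin_field_spec p f y -> lin_field_spec p f z -> y = z.
Proof.
move=> [d [P [Q [hP hQ Q0 E ->]]]] [e [R [S [hR hS S0 E' ->]]]].
pose N := P * S - R * Q.
have hN : mhomog (fun j => d j + e j)%N N.
  apply: mhomogB; first exact: mhomogM.
  apply: (@mhomog_eq _ _ (fun j => e j + d j)%N); last exact: mhomogM.
  by move=> j; apply: addnC.
have nQ : near p (fun q => Q.@[hcoord X q] != 0) by exists d, Q.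
have nS : near p (fun q => S.@[hcoord X q] != 0) by exists e, S.
have NN : near p (fun q => N.@[hcoord X q] = 0).
  apply: near_mono (near_and (near_and E E') (near_and nQ nS)).
  move=> q [[-> /eqP]] + [Qq Sq]; rewrite eqr_div // => /eqP PS.
  by rewrite mevalB !mevalM PS subrr.
have := near_point NN; rewrite mevalB !mevalM => /eqP; rewrite subr_eq0 => /eqP e0.
have := lin_deriv_tangent hN NN.
rewrite lin_derivD lin_derivN !lin_derivM mevalD mevalN !mevalD !mevalM => e1.
rewrite /quot_deriv.
set P0 := P.@[_] in e0 e1 *; set R0 := R.@[_] in e0 e1 *.
set Q1 := Q.@[_] in Q0 e0 e1 *; set S1 := S.@[_] in S0 e0 e1 *.
set P' := (lin_deriv P).@[_] in e1 *; set R' := (lin_deriv R).@[_] in e1 *.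
set Q' := (lin_deriv Q).@[_] in e1 *; set S' := (lin_deriv S).@[_] in e1 *.
have -> : R0 = P0 * S1 / Q1 by rewrite e0 mulfK.
have -> : R' = (P' * S1 + P0 * S' - R0 * Q') / Q1.
  apply: (mulIf Q0); rewrite divfK //; apply/eqP; rewrite -subr_eq0 -oppr_eq0.
  by apply/eqP; rewrite -e1; ring.
have -> : R0 = P0 * S1 / Q1 by rewrite e0 mulfK.
by field; rewrite Q0 S0.
Qed.

(** A function does not carry a fraction representing it, so the value is picked classically; it is
    0 if [f] has no local fraction at [p]. *)
Definition lin_field p f : F :=
  if pselect (exists y, lin_field_spec p f y) is left h then projT1 (cid h) else 0.

Lemma lin_fieldE p f y : lin_field_spec p f y -> lin_field p f = y.
Proof.
rewrite /lin_field => fy; case: pselect => [h|[]]; last by exists y.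
by case: cid => z /= /lin_field_spec_uniq; apply.
Qed.

Lemma lin_field_quot p f d P Q : mhomog d P -> mhomog d Q ->
  Q.@[hcoord X p] != 0 ->
  near p (fun q => f q = P.@[hcoord X q] / Q.@[hcoord X q]) ->
  lin_field p f = quot_deriv p P Q.
Proof. by move=> hP hQ Q0 E; apply: lin_fieldE; exists d, P, Q. Qed.

Lemma lin_field_ratio p i j : fac X i = fac X j -> hcoord X p j != 0 ->
  lin_field p (ratio i j) =
  (lin_vec (hcoord X p) i * hcoord X p j - hcoord X p i * lin_vec (hcoord X p) j)
  / hcoord X p j ^+ 2.
Proof.
move=> ij pj; rewrite (@lin_field_quot _ _ _ 'X_i 'X_j _ (@mhomogX _ _ j)).
- by rewrite /quot_deriv !lin_derivX !mevalXU.
- by rewrite -ij; apply: mhomogX.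
- by rewrite mevalXU.
- by apply: near_all => q; rewrite !mevalXU.
Qed.

Lemma lin_field_vector_field : vector_field lin_field.
Proof.
split=> [p|p f [d [P [Q [hP hQ Q0 E]]]]]; last first.
  exists (fun j => d j + d j)%N, (lin_deriv P * Q - P * lin_deriv Q), (Q * Q).
  split.
  - by apply: mhomogB; apply: mhomogM => //; apply: mhomog_lin_deriv.
  - exact: mhomogM.
  - by rewrite mevalM mulf_neq0.
  move=> q; rewrite mevalM mulf_eq0 orbb => Qq.
  rewrite (lin_field_quot hP hQ Qq); last by exists d, Q.
  by rewrite /quot_deriv mevalB !mevalM expr2.
split=> [a f g|f g] [d [P [Q [hP hQ Q0 E]]]] [e [R [S [hR hS S0 E']]]].
  have nf : near p (fun q => f q = P.@[hcoord X q] / Q.@[hcoord X q]) by exists d, Q.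
  have ng : near p (fun q => g q = R.@[hcoord X q] / S.@[hcoord X q]) by exists e, S.
  rewrite (lin_field_quot hP hQ Q0 nf) (lin_field_quot hR hS S0 ng).
  have hRQ : mhomog (fun j => d j + e j)%N (R * Q).
    apply: (@mhomog_eq _ _ (fun j => e j + d j)%N); last exact: mhomogM.
    by move=> j; apply: addnC.
  have hN : mhomog (fun j => d j + e j)%N (a *: (P * S) + R * Q).
    by apply: mhomogD => //; apply: mhomogZ; apply: mhomogM.
  have hD : mhomog (fun j => d j + e j)%N (Q * S) by apply: mhomogM.
  rewrite (lin_field_quot hN hD).
  - rewrite /quot_deriv -mul_mpolyC lin_derivD !lin_derivM lin_derivC.
    by rewrite !(mevalD, mevalM, mevalC, meval0); field; rewrite Q0 S0.
  - by rewrite mevalM mulf_neq0.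
  exists (fun j => d j + e j)%N, (Q * S); split; first exact: mhomogM.
    by rewrite mevalM mulf_neq0.
  move=> q; rewrite mevalD mevalZ !mevalM mulf_eq0 negb_or => /andP[Qq Sq].
  by rewrite E // E' //; field; rewrite Qq Sq.
have nf : near p (fun q => f q = P.@[hcoord X q] / Q.@[hcoord X q]) by exists d, Q.
have ng : near p (fun q => g q = R.@[hcoord X q] / S.@[hcoord X q]) by exists e, S.
rewrite (lin_field_quot hP hQ Q0 nf) (lin_field_quot hR hS S0 ng).
have hN : mhomog (fun j => d j + e j)%N (P * R) by apply: mhomogM.
have hD : mhomog (fun j => d j + e j)%N (Q * S) by apply: mhomogM.
rewrite (lin_field_quot hN hD).
- rewrite E // E' // /quot_deriv !lin_derivM !(mevalD, mevalM).
  by field; rewrite Q0 S0.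
- by rewrite mevalM mulf_neq0.
exists (fun j => d j + e j)%N, (Q * S); split; first exact: mhomogM.
  by rewrite mevalM mulf_neq0.
move=> q; rewrite !mevalM mulf_eq0 negb_or => /andP[Qq Sq].
by rewrite E // E' // mulf_div.
Qed.

End LinearField.

(** * Coordinates on S x S *)

Section ProjectiveSpace.
Variables (F : fieldType) (n : nat).
Implicit Types L : projsp F n.

Lemma vpick_proj_neq0 L : vpick (val L) != 0.
Proof. by rewrite vpick0 -dimv_eq0 (eqP (valP L)). Qed.

Lemma proj_line L : val L = <[vpick (val L)]>%VS.
Proof.
apply/esym/eqP; rewrite eqEdim (eqP (valP L)) dim_vline vpick_proj_neq0 andbT.
exact: memv_pick.
Qed.

Lemma hcoord_proj_neq0 L : exists i, hcoord (projsp F n) L i != 0.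
Proof.
have [i ui] : exists i, vpick (val L) 0 i != 0; last by exists i.
apply/existsP; apply: contraT => /existsPn u0.
case/eqP: (vpick_proj_neq0 L); apply/rowP => i; rewrite mxE.
by apply/eqP/negPn/u0.
Qed.

Lemma proj_eq L L' (a : F) : a != 0 ->
  (forall i, hcoord (projsp F n) L i = a * hcoord (projsp F n) L' i) -> L = L'.
Proof.
move=> a0 E; apply: val_inj; rewrite (proj_line L) (proj_line L').
have -> : vpick (val L) = a *: vpick (val L') by apply/rowP => i; rewrite mxE -E.
apply/eqP; rewrite eqEsubv; apply/andP; split; first by rewrite -memvE memvZ ?memv_line.
by rewrite -[X in (<[X]> <= _)%VS](scalerK a0) -memvE memvZ ?memv_line.
Qed.

Lemma proj_exists (u : 'I_n.+1 -> F) : (exists i, u i != 0) ->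
  exists L (a : F), a != 0 /\ forall i, hcoord (projsp F n) L i = a * u i.
Proof.
move=> [i ui]; pose r : 'rV[F]_n.+1 := \row_j u j.
have r0 : r != 0 by apply: contraNneq ui => /rowP/(_ i); rewrite !mxE => ->.
have dL : \dim <[r]> == 1%N by rewrite dim_vline r0.
have /vlineP[a aE] := memv_pick <[r]>.
exists (exist _ <[r]>%VS dL : projsp F n), a; split; last by move=> j; rewrite /= aE !mxE.
by apply: contraNneq (vpick_proj_neq0 (exist _ <[r]>%VS dL)) => a0; rewrite /= aE a0 scale0r.
Qed.

End ProjectiveSpace.

Section Coordinates.
Variable F : fieldType.

Definition dP7sq := mpprod (dP7 F) (dP7 F).

(* [(k, inl (Some e))] and [(k, inl None)] name the coordinates x_e and z of
   P^2 in the k-th copy of S, where x_false = x and x_true = y;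
   [(k, inr (e, true))] and [(k, inr (e, false))] name the coordinates
   (a_e : b_e) of the P^1 on which the blow-up relation is x_{~e} b_e = z a_e. *)
Definition cname := (bool * (option bool + bool * bool))%type.

Definition idx1 (w : option bool + bool * bool) : 'I_(3 + (2 + 2)) :=
  match w with
  | inl o => lshift (2 + 2)
      (match o with Some false => 0 | Some true => 1 | None => 2 end : 'I_3)
  | inr (e, c) => rshift 3
      (let k : 'I_2 := if c then 0 else 1 in if e then rshift 2 k else lshift 2 k)
  end.

Definition idx (v : cname) : 'I_(nvars dP7sq) :=
  if v.1 then rshift (3 + (2 + 2)) (idx1 v.2) else lshift (3 + (2 + 2)) (idx1 v.2).

Definition pcomp (k : bool) (p : dP7sq) : dP7 F := if k then p.2 else p.1.

Definition coord (p : dP7sq) (v : cname) : F := hcoord dP7sq p (idx v).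

Lemma split_lshift m n (i : 'I_m) : split (lshift n i) = inl i.
Proof. exact: (unsplitK (inl i)). Qed.

Lemma split_rshift m n (i : 'I_n) : split (rshift m i) = inr i.
Proof. exact: (unsplitK (inr i)). Qed.

Definition pcoord (q : dP7 F) (w : option bool + bool * bool) : F :=
  let: (l, (m0, m1)) := val q in
  match w with
  | inl o => hcoord (projsp F 2) l
      (match o with Some false => 0 | Some true => 1 | None => 2 end)
  | inr (e, c) => hcoord (projsp F 1) (if e then m1 else m0) (if c then 0 else 1)
  end.

Lemma coordE p v : coord p v = pcoord (pcomp v.1 p) v.2.
Proof.
rewrite /coord /idx /pcoord /=; case: v => -[] w /=;
  rewrite ?split_rshift ?split_lshift /=;
  [case: (p.2)|case: (p.1)] => -[l [m0 m1]] Hp /=;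
  (case: w => [o|[[] c]] /=; rewrite ?split_lshift ?split_rshift //=;
   rewrite ?split_lshift ?split_rshift //=).
Qed.

Lemma idx_surj i : exists v, i = idx v.
Proof.
have idx1_surj (j : 'I_(3 + (2 + 2))) : exists w, j = idx1 w.
  have two (k : 'I_2) : exists c : bool, k = if c then 0 else 1.
    by case: k => -[|[|]] // h; [exists true|exists false]; apply: val_inj.
  rewrite -(splitK j); case: (split j) => [o|j'] /=.
    case: o => -[|[|[|]]] // h.
    - by exists (inl (Some false)); congr lshift; apply: val_inj.
    - by exists (inl (Some true)); congr lshift; apply: val_inj.
    - by exists (inl None); congr lshift; apply: val_inj.
  rewrite -(splitK j'); case: (split j') => k /=; have [c ->] := two k.
    by exists (inr (false, c)).
  by exists (inr (true, c)).
rewrite -(splitK i); case: (split i) => j /=; have [w ->] := idx1_surj j.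
  by exists (false, w).
by exists (true, w).
Qed.

Lemma idx_inj : injective idx.
Proof.
have idx1_inj : injective idx1.
  move=> [o|[e c]] [o'|[e' c']] /= /(congr1 (@split _ _));
    rewrite ?split_lshift ?split_rshift // => -[].
    by case: o => [[]|]; case: o' => [[]|].
  move/(congr1 (@split _ _)); case: e; case: e' => //;
  rewrite ?split_lshift ?split_rshift // => -[];
  by case: c; case: c'.
move=> [k w] [k' w'] /(congr1 (@split _ _)); rewrite /idx /=.
by case: k; case: k'; rewrite ?split_lshift ?split_rshift // => -[/idx1_inj ->].
Qed.

Definition cfac (v : cname) : factor dP7sq :=
  let f : unit + (unit + unit) :=
    match v.2 with
    | inl _ => inl tt | inr (false, _) => inr (inl tt) | inr (true, _) => inr (inr tt)
    end in
  if v.1 then inr f else inl f.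

Lemma fac_idx v : fac dP7sq (idx v) = cfac v.
Proof.
case: v => -[] [o|[[] c]]; rewrite /cfac /idx /=;
by do 3![rewrite ?split_rshift ?split_lshift //=].
Qed.

Lemma cfac_surj j : exists v, cfac v = j.
Proof.
by case: j => -[[]|[[]|[]]]; [exists (false, inl None)|exists (false, inr (false, true))
 |exists (false, inr (true, true))|exists (true, inl None)|exists (true, inr (false, true))
 |exists (true, inr (true, true))].
Qed.

Implicit Types (p q : dP7sq) (k e : bool).

Definition xc k e p := coord p (k, inl (Some e)).
Definition zc k p := coord p (k, inl None).
Definition ac k e p := coord p (k, inr (e, true)).
Definition bc k e p := coord p (k, inr (e, false)).

Lemma blowup_rel k e p : xc k (~~ e) p * bc k e p = zc k p * ac k e p.
Proof.
rewrite /xc /bc /zc /ac !coordE /=.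
case: (pcomp k p) => -[l [m0 m1]] /= H; have /andP[/eqP h0 /eqP h1] := H.
by rewrite /pcoord /=; case: e.
Qed.

Lemma plane_neq0 k p : [\/ xc k false p != 0, xc k true p != 0 | zc k p != 0].
Proof.
rewrite /xc /zc !coordE /=; case: (pcomp k p) => -[l [m0 m1]] /= H.
have [[[|[|[|]]] // h]] := hcoord_proj_neq0 l; rewrite /pcoord /=.
- by rewrite (_ : Ordinal h = 0) => [?|]; [constructor 1|apply: val_inj].
- by rewrite (_ : Ordinal h = 1) => [?|]; [constructor 2|apply: val_inj].
- by rewrite (_ : Ordinal h = 2) => [?|]; [constructor 3|apply: val_inj].
Qed.

Lemma line_neq0 k e p : ac k e p != 0 \/ bc k e p != 0.
Proof.
rewrite /ac /bc !coordE /=; case: (pcomp k p) => -[l [m0 m1]] /= H.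
have [[[|[|]] // h]] := hcoord_proj_neq0 (if e then m1 else m0); rewrite /pcoord /=.
- by rewrite (_ : Ordinal h = 0) => [?|]; [left|apply: val_inj].
- by rewrite (_ : Ordinal h = 1) => [?|]; [right|apply: val_inj].
Qed.

Lemma point_eq p q (lam : factor dP7sq -> F) : (forall j, lam j != 0) ->
  (forall v, coord p v = lam (cfac v) * coord q v) -> p = q.
Proof.
move=> l0 E.
suff C k : pcomp k p = pcomp k q.
  by case: p q C {E} => p0 p1 [q0 q1] C; congr pair; [exact: (C false)|exact: (C true)].
have Ek w := E (k, w); move: Ek.
have {}Ek w : pcoord (pcomp k p) w = lam (cfac (k, w)) * pcoord (pcomp k q) w.
  by rewrite -!(coordE _ (k, w)).
move=> _; apply: val_inj; move: Ek.
case: (pcomp k p) => -[l [m0 m1]] Hp; case: (pcomp k q) => -[l' [m0' m1']] Hq /= Ek.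
congr (_, (_, _)).
- apply: (proj_eq (l0 (cfac (k, inl None)))) => -[[|[|[|]]] // h].
  + by rewrite (_ : Ordinal h = 0); [exact: (Ek (inl (Some false)))|apply: val_inj].
  + by rewrite (_ : Ordinal h = 1); [exact: (Ek (inl (Some true)))|apply: val_inj].
  + by rewrite (_ : Ordinal h = 2); [exact: (Ek (inl None))|apply: val_inj].
- apply: (proj_eq (l0 (cfac (k, inr (false, true))))) => -[[|[|]] // h].
  + by rewrite (_ : Ordinal h = 0); [exact: (Ek (inr (false, true)))|apply: val_inj].
  + by rewrite (_ : Ordinal h = 1); [exact: (Ek (inr (false, false)))|apply: val_inj].
- apply: (proj_eq (l0 (cfac (k, inr (true, true))))) => -[[|[|]] // h].
  + by rewrite (_ : Ordinal h = 0); [exact: (Ek (inr (true, true)))|apply: val_inj].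
  + by rewrite (_ : Ordinal h = 1); [exact: (Ek (inr (true, false)))|apply: val_inj].
Qed.

(** The multicone over S x S: exactly such tuples are homogeneous coordinates of points. *)
Definition on_cone (c : cname -> F) := forall k,
  [/\ exists o, c (k, inl o) != 0,
      forall e, exists b, c (k, inr (e, b)) != 0
    & forall e, c (k, inl (Some (~~ e))) * c (k, inr (e, false)) =
                c (k, inl None) * c (k, inr (e, true))].

Lemma point_exists (c : cname -> F) : on_cone c ->
  exists p (lam : factor dP7sq -> F), (forall j, lam j != 0) /\
    forall v, coord p v = lam (cfac v) * c v.
Proof.
move=> cc.
have half k : exists (q : dP7 F) (lam : unit + (unit + unit) -> F),
    (forall j, lam j != 0) /\ forall w, pcoord q w =
      lam match w with inl _ => inl tt | inr (false, _) => inr (inl tt)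
          | inr (true, _) => inr (inr tt) end * c (k, w).
  have [nl nm rel] := cc k.
  pose ul (i : 'I_3) := c (k, inl
    (if i == 0 then Some false else if i == 1 then Some true else None)).
  pose um e (i : 'I_2) := c (k, inr (e, i == 0)).
  have [l [a [a0 lE]]] : exists L (a : F), a != 0 /\
      forall i, hcoord (projsp F 2) L i = a * ul i.
    by apply: proj_exists; have [[[]|] no] := nl; [exists 1|exists 0|exists 2].
  have [b] : exists b : bool -> F, forall e, b e != 0 /\
     exists M, forall i, hcoord (projsp F 1) M i = b e * um e i.
    have H e : exists b : F, b != 0 /\
        exists M, forall i, hcoord (projsp F 1) M i = b * um e i.
      have [|M [b [b0 ME]]] := proj_exists (u := um e); last by exists b; split=> //; exists M.
      by have [[] nb] := nm e; [exists 0|exists 1].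
    by have [b bE] := choice H; exists b.
  move=> bE; have [b0 [m0 m0E]] := bE false; have [b1 [m1 m1E]] := bE true.
  have ok : (fun p : mpprod (projsp F 2) (mpprod (projsp F 1) (projsp F 1)) =>
       let: (l, (m1, m2)) := p in
       (hcoord (projsp F 2) l 1 * hcoord (projsp F 1) m1 1 ==
        hcoord (projsp F 2) l 2 * hcoord (projsp F 1) m1 0) &&
       (hcoord (projsp F 2) l 0 * hcoord (projsp F 1) m2 1 ==
        hcoord (projsp F 2) l 2 * hcoord (projsp F 1) m2 0)) (l, (m0, m1)).
    rewrite !lE !m0E !m1E /ul /um /=.
    have := rel false; have := rel true; rewrite /= => r1 r0.
    by apply/andP; split; apply/eqP; rewrite mulrACA ?r0 ?r1 mulrACA.
  exists (exist _ (l, (m0, m1)) ok : dP7 F).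
  exists (fun j =>
    match j with inl _ => a | inr (inl _) => b false | inr (inr _) => b true end).
  split; first by case=> [|[]].
  by case=> [[[]|]|[[] []]]; rewrite /pcoord;
    [exact: lE|exact: lE|exact: lE|exact: m1E|exact: m1E|exact: m0E|exact: m0E].
have [q0 [l0 [l0n E0]]] := half false; have [q1 [l1 [l1n E1]]] := half true.
exists (q0, q1), (fun j => match j with inl j => l0 j | inr j => l1 j end).
split; first by case.
by move=> [[] w]; rewrite coordE /= ?E0 ?E1.
Qed.

End Coordinates.

(** * Charts *)

Section Representatives.
Variable F : fieldType.
Local Notation X := (dP7sq F).
Implicit Types (p q : X) (k e : bool) (c : cname -> F).

Definition represents c p := exists lam : factor X -> F,
  (forall j, lam j != 0) /\ forall v, coord p v = lam (cfac F v) * c v.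

(** One component at a time, because the curves used later move in one copy of S and are constant in
    the other. *)
Definition represents_half k c p := exists (m : F) (mu : bool -> F),
  [/\ m != 0, forall e, mu e != 0,
      forall o, coord p (k, inl o) = m * c (k, inl o)
    & forall e b, coord p (k, inr (e, b)) = mu e * c (k, inr (e, b))].

Lemma representsP c p : represents c p <-> forall k, represents_half k c p.
Proof.
split=> [[lam [l0 E]] k|H].
  exists (lam (cfac F (k, inl None))), (fun e => lam (cfac F (k, inr (e, true)))).
  by split=> // [o|[] b]; rewrite E.
have [m0 [mu0 [m0n mu0n E0 E0']]] := H false.
have [m1 [mu1 [m1n mu1n E1 E1']]] := H true.
pose h m (mu : bool -> F) (j : unit + (unit + unit)) : F :=
  match j with inl _ => m | inr (inl _) => mu false | inr (inr _) => mu true end.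
exists (fun j => match j with inl j => h m0 mu0 j | inr j => h m1 mu1 j end).
split; first by case=> -[|[]] /=.
by move=> [[] [o|[[] b]]]; rewrite /cfac /= ?E0 ?E0' ?E1 ?E1'.
Qed.

Lemma represents_uniq c p q : represents c p -> represents c q -> p = q.
Proof.
move=> [l [l0 E]] [m [m0 E']]; apply: (@point_eq _ _ _ (fun j => l j / m j)).
  by move=> j; rewrite mulf_neq0 // invr_eq0.
by move=> v; rewrite E E' mulrA divfK.
Qed.

Lemma represents_exists c : on_cone c -> exists p, represents c p.
Proof. exact: point_exists. Qed.

Lemma represents_half_coord k p : represents_half k (coord p) p.
Proof.
exists 1, (fun=> 1); split=> [|e|o|e b]; rewrite ?oner_neq0 ?mul1r //.
Qed.

(* The strict transform E_e of a centre, resp. the line L through both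
   centres, and the corner point q_e in which E_e meets L. *)
Definition on_curve k (T : option bool) p :=
  if T is Some e then xc k (~~ e) p = 0 /\ zc k p = 0
  else bc k false p = 0 /\ bc k true p = 0.

Definition is_corner k e p := on_curve k (Some e) p /\ on_curve k None p.

Lemma on_exceptional k e p : on_curve k (Some e) p ->
  [/\ xc k e p != 0, bc k (~~ e) p = 0 & ac k (~~ e) p != 0].
Proof.
move=> [x0 z0]; have xe : xc k e p != 0.
  case: (plane_neq0 k p); rewrite ?z0 ?eqxx //;
  by case: e x0 => /= x0; rewrite ?x0 ?eqxx.
have b0 : bc k (~~ e) p = 0.
  have := blowup_rel k (~~ e) p; rewrite negbK z0 mul0r => /eqP.
  by rewrite mulf_eq0 (negPf xe) => /eqP.
by split=> //; case: (line_neq0 k (~~ e) p); rewrite ?b0 ?eqxx.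
Qed.

(** The equations b_0 = b_1 = 0 cut out the strict transform; z = 0 alone would give the total
    transform, which also contains E_0 and E_1. *)
Lemma on_line k p : on_curve k None p ->
  [/\ zc k p = 0, forall e, ac k e p != 0 & exists e, xc k e p != 0].
Proof.
move=> [b0 b1]; have b e : bc k e p = 0 by case: e.
have a e : ac k e p != 0 by case: (line_neq0 k e p); rewrite ?b ?eqxx.
have z0 : zc k p = 0.
  have := blowup_rel k true p; rewrite b mulr0 => /esym/eqP.
  by rewrite mulf_eq0 (negPf (a true)) orbF => /eqP.
split=> //; case: (plane_neq0 k p); rewrite ?z0 ?eqxx // => x0.
  by exists false.
by exists true.
Qed.

Lemma is_cornerP k e p : is_corner k e p <-> on_curve k (Some e) p /\ bc k e p = 0.
Proof.
split=> [[E [b0 b1]]|[E b0]]; split=> //; first by case: e {E}.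
by have [_ b1 _] := on_exceptional E; case: e b0 b1 {E} => /= ? ?; split.
Qed.

Lemma corner_half k e p q : is_corner k e p -> is_corner k e q ->
  represents_half k (coord q) p.
Proof.
have H r : is_corner k e r -> [/\ xc k e r != 0, forall e', ac k e' r != 0,
    xc k (~~ e) r = 0 /\ zc k r = 0 & forall e', bc k e' r = 0].
  move=> [E L]; have [_ a _] := on_line L; have [x _ _] := on_exceptional E.
  by split=> // e'; case: L; case: e'.
move=> /H[px pa [px' pz] pb] /H[qx qa [qx' qz] qb].
exists (xc k e p / xc k e q), (fun e' => ac k e' p / ac k e' q); split.
- by apply: mulf_neq0 px _; rewrite invr_eq0.
- by move=> e'; apply: mulf_neq0 (pa e') _; rewrite invr_eq0; apply: qa.
- move=> [e'|]; last by rewrite -/(zc k p) -/(zc k q) pz qz mulr0.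
  rewrite -/(xc k e' p) -/(xc k e' q).
  have [->|ne] := eqVneq e' e; first by rewrite divfK; [|exact: qx].
  have -> : e' = ~~ e by case: (e') ne; case: (e).
  by rewrite px' qx' mulr0.
move=> e' [].
  by rewrite -/(ac k e' p) -/(ac k e' q) divfK; [|exact: qa].
by rewrite -/(bc k e' p) -/(bc k e' q) pb qb mulr0.
Qed.

Lemma corner_eq (f : bool -> bool) p q :
  (forall k, is_corner k (f k) p) -> (forall k, is_corner k (f k) q) -> p = q.
Proof.
move=> hp hq; apply: (@represents_uniq (coord q)); apply/representsP => k.
  exact: corner_half (hp k) (hq k).
exact: represents_half_coord.
Qed.

Lemma corner_exists (f : bool -> bool) : exists p, forall k, is_corner k (f k) p.
Proof.
(* In copy [k] the plane point is the centre with index [f k], and both points (a : b) are (1 :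
   0). *)
pose c (v : cname) : F := match v.2 with
  | inl (Some e) => (e == f v.1)%:R | inl None => 0 | inr (_, b) => b%:R end.
have [|p /representsP cp] := @represents_exists c.
  move=> k; split=> [|e|e]; rewrite /c /=.
  - by exists (Some (f k)); rewrite eqxx oner_neq0.
  - by exists true; rewrite oner_neq0.
  - by rewrite mulr0 mul0r.
exists p => k; have [m [mu [_ _ E E']]] := cp k.
apply/is_cornerP; rewrite /on_curve /xc /zc /bc E E E' /c /= !mulr0.
by case: (f k); rewrite mulr0.
Qed.

End Representatives.

Section Charts.
Variable F : closedFieldType.
Local Notation X := (dP7sq F).
Implicit Types (p q : X) (k e : bool) (c : cname -> F).

Definition cratio (v w : cname) : X -> F := ratio (idx F v) (idx F w).

Lemma cratioE v w p : cratio v w p = coord p v / coord p w.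
Proof. by []. Qed.

Lemma regular_cratio v w p : cfac F v = cfac F w -> coord p w != 0 ->
  regular_at (cratio v w) p.
Proof. by move=> vw pw; apply: regular_ratio => //; rewrite !fac_idx. Qed.

Lemma near_cname p v : coord p v != 0 -> near p (fun q => coord q v != 0).
Proof. exact: near_coord. Qed.

(* Two coordinate charts around E_e in the k-th copy of S: for [b = true],
   where x_e and a_e do not vanish, the coordinates are b_e / a_e and
   x_{~e} / x_e; for [b = false], where x_e and b_e do not vanish, they are
   a_e / b_e and z / x_e. *)
Definition in_chart k (eb : bool * bool) p :=
  xc k eb.1 p != 0 /\ coord p (k, inr eb) != 0.

Definition fst_chart k (eb : bool * bool) : X -> F :=
  cratio (k, inr (eb.1, ~~ eb.2)) (k, inr eb).

Definition snd_chart k (eb : bool * bool) : X -> F :=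
  cratio (k, inl (if eb.2 then Some (~~ eb.1) else None)) (k, inl (Some eb.1)).

(** Where x_e is nonzero the other exceptional curve is absent, so only the P^1 with index e needs
    two charts. *)
Lemma in_chart_ac k eb p : in_chart k eb p -> ac k (~~ eb.1) p != 0.
Proof.
move=> [x0 _]; case: (line_neq0 k (~~ eb.1) p) => // b0.
apply: contraNneq b0 => a0; have := blowup_rel k (~~ eb.1) p.
by rewrite negbK a0 mulr0 => /eqP; rewrite mulf_eq0 (negPf x0).
Qed.

Lemma near_chart k eb p : in_chart k eb p ->
  near p (fun q => in_chart k eb q /\ ac k (~~ eb.1) q != 0).
Proof.
move=> pc; apply: near_and; last exact/near_cname/in_chart_ac/pc.
by case: pc => x0 c0; apply: near_and; apply: near_cname.
Qed.

Lemma regular_fst_chart k eb p : in_chart k eb p -> regular_at (fst_chart k eb) p.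
Proof. by move=> [_ c0]; apply: regular_cratio => //; case: eb c0 => -[] []. Qed.

Lemma regular_snd_chart k eb p : in_chart k eb p -> regular_at (snd_chart k eb) p.
Proof. by move=> [x0 _]; apply: regular_cratio. Qed.

(** The denominators for dehomogenising: one nonvanishing coordinate in each projective factor, when
    copy [k] is viewed in the chart [f k]. *)
Definition chart_ref (f : bool -> bool * bool) (v : cname) : cname :=
  match v with
  | (k, inl _) => (k, inl (Some (f k).1))
  | (k, inr (l, _)) => (k, inr (l, if l == (f k).1 then (f k).2 else true))
  end.

(** Two of the ratios are the chart coordinates. By one blow-up relation the remaining plane ratio
    is their product; by the other, b/a on the P^1 away from the chart equals z / x_e. *)
Lemma chart_ratio_spanned (I : finType) (x : I -> X -> F) p k (f : bool -> bool * bool) w :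
  in_chart k (f k) p ->
  spanned p x (fst_chart k (f k)) -> spanned p x (snd_chart k (f k)) ->
  spanned p x (cratio (k, w) (chart_ref f (k, w))).
Proof.
move=> pc s1 s2; have np := near_chart pc.
have one v : coord p v != 0 -> spanned p x (cratio v v).
  move=> v0; apply: (@spanned_near _ _ _ _ _ _ (fun=> 1)); last exact: spanned_cst.
  by apply: near_mono (near_cname v0) => q q0; rewrite cratioE divff.
have sM := spannedM s1 s2.
have sX o : spanned p x (cratio (k, inl o) (k, inl (Some (f k).1))).
  have [oe|oe] := eqVneq o (Some (f k).1); first by rewrite oe; apply/one/pc.1.
  have [ob|ob] := eqVneq o (if (f k).2 then Some (~~ (f k).1) else None).
    by rewrite ob.
  apply: spanned_near sM; apply: near_mono np => q [[x0 c0] _].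
  rewrite /fst_chart /snd_chart !cratioE.
  have := blowup_rel k (f k).1 q; move: x0 c0 oe ob; rewrite /xc /zc /bc /ac.
  case: (f k) => e [] /=.
    case: o => [e'|] x0 c0; last first.
      move=> _ _ E.
      by rewrite mulf_div [coord q _ * coord q (k, inl _)]mulrC E; field; rewrite c0 x0.
    by move=> /eqP h1 /eqP h2 _; case: h1; congr Some; case: e' h2; case: (e) => // -[].
  case: o => [e'|] x0 c0 // h1 _ E.
  have -> : e' = ~~ e by case: e' h1; case: (e); rewrite ?eqxx.
  by rewrite mulf_div [coord q _ * coord q (k, inl _)]mulrC -E; field; rewrite c0 x0.
case: w => [o|[l b]] /=; first exact: sX.
have [->|ne] := eqVneq l (f k).1.
  have [->|nb] := eqVneq b (f k).2; first by apply: one; move: pc.2; case: (f k).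
  have -> : b = ~~ (f k).2 by case: b nb; case: (f k).2.
  by move: s1; rewrite /fst_chart; case: (f k).
have {ne}-> : l = ~~ (f k).1 by case: l ne; case: (f k).1.
case: b; first exact/one/in_chart_ac/pc.
apply: spanned_near (sX None); apply: near_mono np => q [[x0 c0] a0].
have := blowup_rel k (~~ (f k).1) q; rewrite negbK !cratioE => E.
by apply/eqP; rewrite eqr_div // mulrC; apply/eqP.
Qed.

(** E_e is parametrised by its P^1 and L by the plane coordinates, so the two chart coordinates
    exchange roles. *)
Definition tangential (T : option bool) k eb :=
  if T is Some _ then fst_chart k eb else snd_chart k eb.

Definition normal (T : option bool) k eb :=
  if T is Some _ then snd_chart k eb else fst_chart k eb.

Lemma regular_tangential T k eb p : in_chart k eb p ->
  regular_at (tangential T k eb) p.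
Proof.
by case: T => [?|] pc; [exact: regular_fst_chart|exact: regular_snd_chart].
Qed.

Lemma regular_normal T k eb p : in_chart k eb p ->
  regular_at (normal T k eb) p.
Proof.
by case: T => [?|] pc; [exact: regular_snd_chart|exact: regular_fst_chart].
Qed.

Lemma quadruple_spanned p T k (f : bool -> bool * bool) :
  (forall k, in_chart k (f k) p) ->
  let x := quadruple (tangential T k (f k)) (normal T k (f k))
                     (fst_chart (~~ k) (f (~~ k))) (snd_chart (~~ k) (f (~~ k))) in
  (forall i, regular_at (x i) p) /\ forall g, regular_at g p -> spanned p x g.
Proof.
move=> pc x.
have rx i : regular_at (x i) p.
  by apply: (quadruple_forall (A := fun h => regular_at h p));
     [apply: regular_tangential|apply: regular_normal
     |apply: regular_fst_chart|apply: regular_snd_chart].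
split=> // g rg.
pose nm j := projT1 (cid (@cfac_surj F j)).
have nmE j : cfac F (nm j) = j by rewrite /nm; case: cid.
have ref_fac v w : cfac F v = cfac F w -> chart_ref f v = chart_ref f w.
  by move: v w => [[] [o|[[] b]]] [[] [o'|[[] b']]].
have fac_ref v : cfac F (chart_ref f v) = cfac F v.
  by move: v => [[] [o|[[] b]]].
apply: (@spanned_chart _ _ _ _ _ (fun j => idx F (chart_ref f (nm j)))) => //.
- by move=> j; rewrite fac_idx fac_ref nmE.
- move=> j; rewrite -/(coord p _); case: (nm j) => k' [o|[l b]] /=.
    exact: (pc k').1.
  have [->|ne] := eqVneq l (f k').1; first by move: (pc k').2; case: (f k').
  have -> : l = ~~ (f k').1 by case: l ne; case: (f k').1.
  exact/in_chart_ac/pc.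
move=> i; have [v ->] := idx_surj i; rewrite fac_idx.
rewrite (ref_fac _ v) ?nmE // -/(cratio _ _).
have g0 := spanned_gen rx 0; have g1 := spanned_gen rx 1.
have g2 := spanned_gen rx 2; have g3 := spanned_gen rx 3.
case: v => k' w; have [->|ne] := eqVneq k' k.
  by apply: chart_ratio_spanned => //; move: g0 g1; rewrite /x /quadruple; case: (T).
have -> : k' = ~~ k by case: k' ne; case: (k).
by apply: chart_ratio_spanned.
Qed.

End Charts.

(** * The curves E_0, E_1 and L *)

(* Homogeneous coordinates on the line [T] in the k-th copy of S, with
   parameter (s : t), the other component being fixed by [c]. *)
Definition line_cone (A : nzRingType) (c : cname -> A) (T : option bool) (k : bool)
    (s t : A) (v : cname) : A :=
  if v.1 != k then c v else
  match T, v.2 with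
  | Some e, inl (Some e') => (e' == e)%:R
  | None, inl (Some e') => if e' then t else s
  | _, inl None => 0
  | Some e, inr (e', b) => if e' == e then (if b then s else t) else b%:R
  | None, inr (_, b) => b%:R
  end.

(** With the parameter (s : t) of [line_cone], the curve lies in the first chart where s is nonzero
    and in the second where t is. *)
Definition chart1 (T : option bool) : bool * bool :=
  if T is Some e then (e, true) else (false, true).

Definition chart2 (T : option bool) : bool * bool :=
  if T is Some e then (e, false) else (true, true).

Section Lines.
Variable F : closedFieldType.
Local Notation X := (dP7sq F).
Implicit Types (p q : X) (k e : bool) (T : option bool).

Lemma coord_on_cone p : on_cone (coord p).
Proof.
move=> k; split=> [|e|e]; last exact: blowup_rel.
  by case: (plane_neq0 k p) => h; eexists; apply: h.
by case: (line_neq0 k e p) => h; eexists; apply: h.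
Qed.

Lemma line_on_cone p T k s t :
  s != 0 \/ t != 0 -> on_cone (line_cone (coord p) T k s t).
Proof.
move=> st k'; have [->|ne] := eqVneq k' k; last first.
  have [n1 n2 rel] := coord_on_cone p k'; rewrite /line_cone /= ne.
  by split.
rewrite /line_cone /= eqxx /=; case: T => [e|]; split.
- by exists (Some e); rewrite eqxx oner_neq0.
- move=> e'; have [_|_] := eqVneq e' e; last by exists true; rewrite oner_neq0.
  by case: st => h; [exists true|exists false].
- move=> e'; rewrite mul0r; have [->|] := eqVneq e' e; last by rewrite mulr0.
  by case: (e); rewrite mul0r.
- by case: st => h; [exists (Some false)|exists (Some true)].
- by move=> e'; exists true; rewrite oner_neq0.
- by move=> e'; rewrite mulr0 mul0r.
Qed.

Lemma line_arc p T k (s t : {poly F}) : (forall u, s.[u] != 0 \/ t.[u] != 0) ->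
  exists ga : F -> X,
    (forall u, represents (line_cone (coord p) T k s.[u] t.[u]) (ga u)) /\
    algebraic_arc ga.
Proof.
move=> st; have [ga gaE] := choice (fun u => represents_exists (line_on_cone p T k (st u))).
exists ga; split=> //.
pose nm (i : 'I_(nvars X)) := projT1 (cid (idx_surj i)).
have nmE i : idx F (nm i) = i by rewrite /nm; case: cid.
(* The same cone taken over [{poly F}], with the fixed component as constants; evaluation at [u]
   gives the cone over [F]. *)
exists (fun i => line_cone (fun v => (coord p v)%:P) T k s t (nm i)) => u.
have [lam [l0 E]] := gaE u; exists lam; split=> // i.
have := E (nm i); rewrite /coord -fac_idx nmE => ->; congr (_ * _).
case: (nm i) => k' w; rewrite /line_cone /=; case: (k' != k); first by rewrite hornerC.
have nat (b : bool) : (b%:R : {poly F}).[u] = b%:R.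
  by case: b; rewrite ?hornerC ?horner0.
case: T {E gaE} => [e|]; case: w => [[e'|]|[e' b]] //=; rewrite ?nat ?horner0 //.
  by case: (e' == e) => //; case: b.
by case: e'.
Qed.

(** Of [p] only the component in copy [~~ k] matters. *)
Definition in_line p T k q := on_curve k T q /\ represents_half (~~ k) (coord p) q.

Lemma line_cone_half p T k s t q : represents (line_cone (coord p) T k s t) q ->
  exists (m : F) (mu : bool -> F), [/\ m != 0, forall e, mu e != 0,
   [/\ forall e, xc k e q = m * (if T is Some e' then (e == e')%:R else if e then t else s),
       zc k q = 0,
       forall e, ac k e q = mu e * (if T is Some e' then if e == e' then s else 1 else 1)
     & forall e, bc k e q = mu e * (if T is Some e' then if e == e' then t else 0 else 0)]
    & represents_half (~~ k) (coord p) q].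
Proof.
move=> /representsP r; have [m [mu [m0 mu0 E E']]] := r k.
exists m, mu; split=> //.
  split=> [e||e|e]; rewrite /xc /zc /ac /bc ?E ?E' /line_cone /= eqxx /=.
  - by case: T {r E E'}.
  - by case: T {r E E'} => [?|]; rewrite mulr0.
  - by case: T {r E E'}.
  - by case: T {r E E'}.
have [m' [mu' [m'0 mu'0 F' F'']]] := r (~~ k).
exists m', mu'; split=> // [o|e b]; rewrite ?F' ?F'' /line_cone /=;
by case: (k).
Qed.

Lemma line_cone_in_line p T k s t q :
  represents (line_cone (coord p) T k s t) q -> in_line p T k q.
Proof.
move=> /line_cone_half[m [mu [m0 mu0 [Ex Ez Ea Eb] h]]]; split=> //.
case: T Ex Ea Eb => [e|] Ex Ea Eb /=; first by rewrite Ex Ez; case: (e); rewrite mulr0.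
by rewrite !Eb !mulr0.
Qed.

Lemma line_cone_chart1 p T k s t q : represents (line_cone (coord p) T k s t) q ->
  s != 0 -> [/\ in_chart k (chart1 T) q, tangential T k (chart1 T) q = t / s
              & normal T k (chart1 T) q = 0].
Proof.
move=> /line_cone_half[m [mu [m0 mu0 [Ex Ez Ea Eb] _]]] s0.
case: T Ex Ea Eb => [e|] Ex Ea Eb; rewrite /tangential /normal /= /in_chart
  /fst_chart /snd_chart !cratioE /=
  -?/(xc k _ q) -?/(ac k _ q) -?/(bc k _ q) ?Ex ?Ea ?Eb ?eqxx /=.
  have -> : (~~ e == e) = false by case: (e).
  by split; rewrite ?mulr0 ?mul0r ?mulr1 ?mulf_neq0 // -mulf_div divff // mul1r.
by split; rewrite ?mulr0 ?mul0r ?mulr1 ?mulf_neq0 // -mulf_div divff // mul1r.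
Qed.

Lemma line_cone_chart2 p T k s t q : represents (line_cone (coord p) T k s t) q ->
  t != 0 -> [/\ in_chart k (chart2 T) q, tangential T k (chart2 T) q = s / t
              & normal T k (chart2 T) q = 0].
Proof.
move=> /line_cone_half[m [mu [m0 mu0 [Ex Ez Ea Eb] _]]] s0.
case: T Ex Ea Eb => [e|] Ex Ea Eb; rewrite /tangential /normal /= /in_chart
  /fst_chart /snd_chart !cratioE /=
  -?/(xc k _ q) -?/(zc k q) -?/(ac k _ q) -?/(bc k _ q) ?Ex ?Ez ?Ea ?Eb ?eqxx /=.
  by split; rewrite ?mulr0 ?mul0r ?mulr1 ?mulf_neq0 // -mulf_div divff // mul1r.
by split; rewrite ?mulr0 ?mul0r ?mulr1 ?mulf_neq0 // -mulf_div divff // mul1r.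
Qed.

(** The scalar is absorbed by the P^1 with index e for E_e, and by the plane for L. *)
Lemma line_cone_scale p T k s t a q : a != 0 ->
  represents (line_cone (coord p) T k s t) q ->
  represents (line_cone (coord p) T k (a * s) (a * t)) q.
Proof.
move=> a0 /representsP r; apply/representsP => k'.
have [m [mu [m0 mu0 E E']]] := r k'; have [kk|kk] := eqVneq k' k; last first.
  by exists m, mu; split=> // [o|e b]; rewrite ?E ?E' /line_cone /= kk.
subst k'; case: T {r} E E' => [e|] E E'.
  exists m, (fun e' => if e' == e then mu e' / a else mu e'); split=> //.
    by move=> e'; case: ifP => // _; rewrite mulf_neq0 // invr_eq0.
  move=> e' b; rewrite E' /line_cone /= eqxx /=; case: ifP => // _.
  by case: b; rewrite mulrA divfK.
exists (m / a), mu; split=> //.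
  by rewrite mulf_neq0 // invr_eq0.
move=> o; rewrite E /line_cone /= eqxx /=; case: o => [[]|]; rewrite ?mulr0 //;
  by rewrite mulrA divfK.
Qed.

Lemma in_line_cone p T k q : in_line p T k q -> exists s t,
  (s != 0 \/ t != 0) /\ represents (line_cone (coord p) T k s t) q.
Proof.
move=> [C [m [mu [m0 mu0 E E']]]].
suff [s [t [st [m' [mu' [m'0 mu'0 F1 F2]]]]]] : exists s t, (s != 0 \/ t != 0) /\
    represents_half k (line_cone (coord p) T k s t) q.
  exists s, t; split=> //; apply/representsP => k'; have [->|ne] := eqVneq k' k.
    by exists m', mu'.
  have -> : k' = ~~ k by case: k' ne; case: (k).
  by exists m, mu; split=> // [o|e b]; rewrite ?E ?E' /line_cone /=; case: (k).
case: T C => [e|] C.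
  have [x0 b0 a0] := on_exceptional C; have [x'0 z0] := C.
  exists (ac k e q), (bc k e q); split; first exact: line_neq0.
  exists (xc k e q), (fun e' => if e' == e then 1 else ac k (~~ e) q); split=> //.
  - by move=> e'; case: ifP => // _; rewrite oner_neq0.
  - move=> o; rewrite /line_cone /= eqxx /=; case: o => [e'|]; last by rewrite mulr0.
    have [->|ne] := eqVneq e' e; first by rewrite mulr1.
    by rewrite mulr0; have -> : e' = ~~ e by case: e' ne; case: (e).
  move=> e' b; rewrite /line_cone /= eqxx /=; have [->|ne] := eqVneq e' e.
    by rewrite mul1r; case: b.
  have -> : e' = ~~ e by case: e' ne; case: (e).
  by case: b; rewrite ?mulr1 ?mulr0.
have [z0 a0 [e x0]] := on_line C; exists (xc k false q), (xc k true q).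
split; first by case: e x0; [right|left].
exists 1, (fun e' => ac k e' q); split=> //; first exact: oner_neq0.
  by move=> [[]|]; rewrite /line_cone /= eqxx /= ?mul1r ?mulr0.
move=> e' []; rewrite /line_cone /= eqxx /= ?mulr1 // mulr0.
by case: C => ? ?; case: e'.
Qed.

(** Self-intersection -1. For E_e this is one blow-up relation; for L both are used, since b_1 / a_1
    = z / x_0 and b_0 / a_0 = z / x_1. *)
Lemma normal_glue T k q : in_chart k (chart1 T) q -> in_chart k (chart2 T) q ->
  normal T k (chart2 T) q = tangential T k (chart1 T) q * normal T k (chart1 T) q.
Proof.
case: T => [e|] [/= x1 c1] [/= x2 c2]; rewrite /normal /tangential
  /fst_chart /snd_chart !cratioE /=.
  rewrite mulf_div [coord q (k, inr (e, false)) * _]mulrC.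
  have := blowup_rel k e q; rewrite /xc /zc /ac /bc => ->.
  by field; rewrite c1 x1.
rewrite mulf_div; apply/eqP; rewrite eqr_div ?mulf_neq0 //; apply/eqP.
have := blowup_rel k true q; have := blowup_rel k false q.
rewrite /xc /zc /ac /bc /= => h1 h2.
by rewrite h1 mulrCA mulrA h2; ring.
Qed.

Lemma tangential_glue T k q :
  tangential T k (chart2 T) q = (tangential T k (chart1 T) q)^-1.
Proof. by case: T => [e|]; rewrite /tangential /fst_chart /snd_chart !cratioE invf_div. Qed.

(* The curves E_0, E_1 and L are (-1)-curves in S. *)
Lemma line_exists p T k : exists ga1 ga2,
  [/\ minus_one_line ga1 ga2 (tangential T k (chart1 T)) (normal T k (chart1 T))
                             (tangential T k (chart2 T)) (normal T k (chart2 T)),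
      forall t, in_line p T k (ga1 t) /\ in_chart k (chart1 T) (ga1 t),
      forall t, in_line p T k (ga2 t) /\ in_chart k (chart2 T) (ga2 t)
    & forall q, in_line p T k q ->
        ((exists t, q = ga1 t) \/ q = ga2 0) /\
        (in_chart k (chart1 T) q -> exists t, q = ga1 t) /\
        (in_chart k (chart2 T) q -> exists t, q = ga2 t)].
Proof.
have n1 u : (1 : {poly F}).[u] != 0 \/ ('X : {poly F}).[u] != 0.
  by left; rewrite hornerC oner_neq0.
have n2 u : ('X : {poly F}).[u] != 0 \/ (1 : {poly F}).[u] != 0.
  by right; rewrite hornerC oner_neq0.
have [ga1 [r1 arc1]] := line_arc p T k n1; have [ga2 [r2 arc2]] := line_arc p T k n2.
have {}r1 t : represents (line_cone (coord p) T k 1 t) (ga1 t).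
  by have := r1 t; rewrite hornerC hornerX.
have {}r2 t : represents (line_cone (coord p) T k t 1) (ga2 t).
  by have := r2 t; rewrite hornerC hornerX.
have [o1 o2] : 1 != 0 :> F /\ 1 != 0 :> F by rewrite oner_neq0.
have c1 t := line_cone_chart1 (r1 t) o1; have c2 t := line_cone_chart2 (r2 t) o1.
have glue t : t != 0 -> ga1 t = ga2 t^-1.
  move=> t0; apply: (represents_uniq (r1 t)); have := line_cone_scale t0 (r2 t^-1).
  by rewrite mulfV // mulr1.
have c12 t : t != 0 -> in_chart k (chart2 T) (ga1 t).
  by move=> t0; rewrite glue //; case: (c2 t^-1).
have E1 s t q : s != 0 -> represents (line_cone (coord p) T k s t) q -> q = ga1 (s^-1 * t).
  move=> s0 r; apply: (represents_uniq _ (r1 _)).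
  have sV : s^-1 != 0 by rewrite invr_eq0.
  by have := line_cone_scale sV r; rewrite mulVf.
have E2 s t q : t != 0 -> represents (line_cone (coord p) T k s t) q -> q = ga2 (t^-1 * s).
  move=> t0 r; apply: (represents_uniq _ (r2 _)).
  have tV : t^-1 != 0 by rewrite invr_eq0.
  by have := line_cone_scale tV r; rewrite mulVf.
exists ga1, ga2; split.
- split=> // t.
  + by apply: regular_tangential; case: (c1 t).
  + by apply: regular_normal; case: (c1 t).
  + by apply: regular_tangential; case: (c2 t).
  + by apply: regular_normal; case: (c2 t).
  + by have [_ -> _] := c1 t; rewrite divr1.
  + by case: (c1 t).
  + by move=> _; apply: near_all => q; apply: tangential_glue.
  move=> t0; have [d1 _ _] := c1 t.
  apply: near_mono (near_and (near_chart d1) (near_chart (c12 _ t0))).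
  by move=> q [[h1 _] [h2 _]]; apply: normal_glue.
- by move=> t; split; [exact: line_cone_in_line (r1 t)|case: (c1 t)].
- by move=> t; split; [exact: line_cone_in_line (r2 t)|case: (c2 t)].
move=> q /in_line_cone[s [t [st r]]].
have z1 : s = 0 -> ~ in_chart k (chart1 T) q.
  move=> s0 [x0 a0]; have [m [mu [_ _ [Ex _ Ea _] _]]] := line_cone_half r.
  case: T Ex Ea x0 a0 {r c1 c2 r1 r2 c12 E1 E2} => [e|] Ex Ea /=;
    last by rewrite Ex s0 mulr0 eqxx.
  by rewrite -/(ac k e q) Ea eqxx s0 mulr0 eqxx.
have z2 : t = 0 -> ~ in_chart k (chart2 T) q.
  move=> s0 [x0 a0]; have [m [mu [_ _ [Ex _ _ Eb] _]]] := line_cone_half r.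
  case: T Ex Eb x0 a0 {r c1 c2 r1 r2 c12 E1 E2 z1} => [e|] Ex Eb /=;
    last by rewrite Ex s0 mulr0 eqxx.
  by rewrite -/(bc k e q) Eb eqxx s0 mulr0 eqxx.
split; last split.
- have [s0|s0] := eqVneq s 0; last by left; exists (s^-1 * t); apply: E1.
  have t0 : t != 0 by case: st; rewrite // s0 eqxx.
  by right; rewrite (E2 _ _ _ t0 r) s0 mulr0.
- have [/z1//|s0 _] := eqVneq s 0.
  by exists (s^-1 * t); apply: E1.
- have [/z2//|t0 _] := eqVneq t 0.
  by exists (t^-1 * s); apply: E2.
Qed.

End Lines.

(** * Global vector fields on S x S *)

Section GlobalFields.
Variables (F : closedFieldType) (X : mpset F).
Implicit Types (p q : X) (f g : X -> F) (v w : X -> (X -> F) -> F).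

Definition fields_vanish p := forall v f,
  vector_field v -> regular_at f p -> v p f = 0.

(** Vanishing of all 2 x 2 minors of the pairing of fields with functions; with no basis involved,
    invariance under automorphisms is immediate. *)
Definition fields_rank_le1 p := forall v w f g,
  vector_field v -> vector_field w -> regular_at f p -> regular_at g p ->
  v p f * w p g = v p g * w p f.

Variable ph : automorphism X.

Definition field_pullback v : X -> (X -> F) -> F :=
  fun p f => v (ph p) (fun q => f (aut_inv ph q)).

Lemma regular_inv p f : regular_at f p ->
  regular_at (fun q => f (aut_inv ph q)) (ph p).
Proof. by move=> rf; apply: (@aut_inv_regular _ _ ph); rewrite autK. Qed.

Lemma regular_aut p f : regular_at f (ph p) -> regular_at (fun q => f (ph q)) p.
Proof. exact: aut_regular. Qed.

Lemma vector_field_pullback v : vector_field v -> vector_field (field_pullback v).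
Proof.
move=> [dv rv]; split=> [p|p f rf].
  split=> [a f g|f g] /regular_inv rf /regular_inv rg; rewrite /field_pullback.
    exact: (dv (ph p)).1.
  by rewrite (dv (ph p)).2 // autK.
by apply: (regular_aut (f := fun q => v q _)); apply/rv/regular_inv.
Qed.

Lemma field_pullbackE v p f : field_pullback v p (fun q => f (ph q)) = v (ph p) f.
Proof.
by congr (v _ _); apply/funext => q; rewrite aut_invK.
Qed.

Lemma fields_vanish_aut p : fields_vanish p -> fields_vanish (ph p).
Proof.
move=> H v f Fv rf; rewrite -field_pullbackE.
by apply: H; [apply: vector_field_pullback|apply: regular_aut].
Qed.

Lemma fields_rank_le1_aut p : fields_rank_le1 p -> fields_rank_le1 (ph p).
Proof.
move=> H v w f g Fv Fw rf rg; rewrite -!field_pullbackE.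
by apply: H; try (by apply: vector_field_pullback); apply: regular_aut.
Qed.

Lemma in_zero_locus_aut n (s : polyvector X n) c p :
  semi_invariant ph s c -> in_zero_locus s p -> in_zero_locus s (ph p).
Proof.
move=> inv z h rh; have rh' i : regular_at (fun q => h i (ph q)) p.
  exact/regular_aut/rh.
have := inv p (fun i q => h i (ph q)) rh'; rewrite /pullback z // mulr0 => <-.
by congr (s _ _); apply/funext => i; apply/funext => q; rewrite aut_invK.
Qed.

End GlobalFields.

Section Fields.
Variable F : closedFieldType.
Local Notation X := (dP7sq F).
Implicit Types (p q : X) (k e b : bool) (T : option bool).

(* The infinitesimal automorphisms of S given by the translation
   x_e -> x_e + t z ([b = true]) and the scaling of x_e ([b = false]). *)
Definition affine_field k e b : seq ('I_(nvars X) * 'I_(nvars X)) :=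
  [:: (idx F (k, inl (Some e)), idx F (k, inl (if b then None else Some e)));
      (idx F (k, inr (~~ e, true)), idx F (k, inr (~~ e, ~~ b)))].

Lemma affine_field_vec k e b p v :
  lin_vec (affine_field k e b) (hcoord X p) (idx F v) =
  ((k, inl (Some e)) == v)%:R * coord p (k, inl (if b then None else Some e)) +
  ((k, inr (~~ e, true)) == v)%:R * coord p (k, inr (~~ e, ~~ b)).
Proof.
by rewrite /lin_vec /affine_field !big_cons big_nil addr0 /= !(inj_eq (@idx_inj F)).
Qed.

Lemma affine_field_fac k e b a : a \in affine_field k e b -> fac X a.1 = fac X a.2.
Proof.
have E u w : cfac F u = cfac F w -> fac X (idx F u) = fac X (idx F w).
  by rewrite !fac_idx.
by rewrite !inE => /orP[]/eqP->; apply: E.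
Qed.

(** The relation x_e b_{~e} = z a_{~e} survives because a_{~e} moves together with x_e: it receives
    t b_{~e} under the translation and the factor 1 + t under the scaling. *)
Lemma affine_field_flow k e b p : exists r : {poly F}, r.[0] != 0 /\
  forall t, r.[t] != 0 -> exists q (lam : factor X -> F),
    (forall j, lam j != 0) /\
    forall i, hcoord X q i = lam (fac X i) *
      (hcoord X p i + t * lin_vec (affine_field k e b) (hcoord X p) i).
Proof.
(* The translation is defined for all t, the scaling only for 1 + t nonzero. *)
exists (if b then 1 else 1 + 'X); split.
  by case: b; rewrite !hornerE oner_neq0.
move=> t rt; pose c v := coord p v + t * lin_vec (affine_field k e b) (hcoord X p) (idx F v).
suff /represents_exists[q [lam [l0 E]]] : on_cone c.
  exists q, lam; split=> // i; have [v ->] := idx_surj i.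
  by rewrite fac_idx; apply: E.
have cE v : c v = coord p v +
    t * (((k, inl (Some e)) == v)%:R * coord p (k, inl (if b then None else Some e)) +
         ((k, inr (~~ e, true)) == v)%:R * coord p (k, inr (~~ e, ~~ b))).
  by rewrite /c affine_field_vec.
have cN k' w : k' != k -> c (k', w) = coord p (k', w).
  move=> ne; rewrite cE !xpair_eqE !(eq_sym k) (negPf ne) /=.
  by rewrite !mul0r addr0 mulr0 addr0.
move=> k'; have [n1 n2 rel] := coord_on_cone p k'.
have [ek|ne] := eqVneq k' k; last first.
  split=> [|e'|e']; rewrite ?cN //.
    by have [o no] := n1; exists o; rewrite cN.
  by have [b' nb] := n2 e'; exists b'; rewrite cN.
subst k'.
have cX : c (k, inl (Some e)) =
    coord p (k, inl (Some e)) + t * coord p (k, inl (if b then None else Some e)).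
  by rewrite cE !xpair_eqE !eqxx /= mul1r mul0r addr0.
have cA : c (k, inr (~~ e, true)) =
    coord p (k, inr (~~ e, true)) + t * coord p (k, inr (~~ e, ~~ b)).
  by rewrite cE !xpair_eqE !eqxx /= mul0r mul1r add0r.
have cO v : v != (k, inl (Some e)) -> v != (k, inr (~~ e, true)) -> c v = coord p v.
  move=> h1 h2; rewrite cE ![_ == v]eq_sym (negPf h1) (negPf h2).
  by rewrite !mul0r addr0 mulr0 addr0.
have cX' : c (k, inl (Some (~~ e))) = coord p (k, inl (Some (~~ e))).
  by apply: cO; rewrite xpair_eqE eqxx //=; case: (e).
have cZ : c (k, inl None) = coord p (k, inl None).
  by apply: cO; rewrite xpair_eqE eqxx.
have cB e' : c (k, inr (e', false)) = coord p (k, inr (e', false)).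
  by apply: cO; rewrite xpair_eqE eqxx //=; case: e'; case: (e).
have cA' : c (k, inr (e, true)) = coord p (k, inr (e, true)).
  by apply: cO; rewrite xpair_eqE eqxx //=; case: (e).
have two e' : e' = e \/ e' = ~~ e by case: e'; case: (e); [left|right|right|left].
have t1 : b = false -> 1 + t != 0.
  by move=> b0; move: rt; rewrite b0 !hornerE.
split=> [|e'|e'].
- have [z0|z0] := eqVneq (coord p (k, inl None)) 0; last first.
    by exists None; rewrite cZ.
  have [x0|x0] := eqVneq (coord p (k, inl (Some (~~ e)))) 0; last first.
    by exists (Some (~~ e)); rewrite cX'.
  exists (Some e); rewrite cX; have xe : coord p (k, inl (Some e)) != 0.
    case: n1 => -[e'|]; last by rewrite z0 eqxx.
    by case: (two e') => ->; rewrite // x0 eqxx.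
  case: b t1 {cE cX cA rt c cN cX' cZ cB cA' cO} => t1; first by rewrite z0 mulr0 addr0.
  by rewrite -{1}[coord p _]mul1r -mulrDl mulf_neq0 // t1.
- case: (two e') => ->.
    by case: (n2 e) => -[] h; [exists true|exists false]; rewrite ?cA' ?cB.
  have [b0|b0] := eqVneq (coord p (k, inr (~~ e, false))) 0; last first.
    by exists false; rewrite cB.
  exists true; rewrite cA; have a0 : coord p (k, inr (~~ e, true)) != 0.
    by case: (n2 (~~ e)) => -[]; rewrite // b0 eqxx.
  case: b t1 {cE cX cA rt c cN cX' cZ cB cA' cO} => t1 /=; first by rewrite b0 mulr0 addr0.
  by rewrite -{1}[coord p _]mul1r -mulrDl mulf_neq0 // t1.
case: (two e') => ->; first by rewrite cX' cB cZ cA' rel.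
rewrite negbK cX cB cZ cA; have := rel (~~ e); rewrite negbK => r.
case: (b) => /=; rewrite mulrDl mulrDr r; congr (_ + _); first by ring.
by rewrite -mulrA r; ring.
Qed.

Definition affine_vf k e b := lin_field (affine_field k e b).

Lemma affine_vf_vector_field k e b : vector_field (affine_vf k e b).
Proof.
apply: lin_field_vector_field; [exact: affine_field_fac|exact: affine_field_flow].
Qed.

Lemma affine_vf_ratio k e b p v w : cfac F v = cfac F w -> coord p w != 0 ->
  let D u := ((k, inl (Some e)) == u)%:R * coord p (k, inl (if b then None else Some e)) +
             ((k, inr (~~ e, true)) == u)%:R * coord p (k, inr (~~ e, ~~ b)) in
  affine_vf k e b p (cratio v w) =
  (D v * coord p w - coord p v * D w) / coord p w ^+ 2.
Proof.
move=> vw pw D; rewrite /affine_vf lin_field_ratio //.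
- by rewrite !affine_field_vec.
- exact: affine_field_flow.
- by rewrite !fac_idx.
Qed.

Lemma affine_vf_other k e b p v w : cfac F v = cfac F w -> coord p w != 0 ->
  v.1 != k -> affine_vf k e b p (cratio v w) = 0.
Proof.
move=> vw pw vk; rewrite affine_vf_ratio //.
have wk : w.1 != k.
  by case: v w vw vk {pw} => [[] [?|[[] ?]]] [[] [?|[[] ?]]].
case: v w vw pw vk wk => [kv v] [kw w] _ _ /= vk wk.
by rewrite !xpair_eqE ![k == _]eq_sym (negPf vk) (negPf wk) /= !(mul0r, add0r, mulr0, oppr0).
Qed.

(** Off z = 0 a translation moves x/z. On E_e away from the corner b_e is nonzero, and translating
    x_{~e} moves a_e / b_e. On the rest of z = 0 both x and y are nonzero, and scaling y moves
    y/x. *)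
Lemma affine_vf_moves k p : (forall e, ~ is_corner k e p) ->
  exists e b v w, [/\ cfac F v = cfac F w, v.1 = k, coord p w != 0 &
    affine_vf k e b p (cratio v w) != 0].
Proof.
move=> nc; have [z0|z0] := eqVneq (zc k p) 0; last first.
  exists false, true, (k, inl (Some false)), (k, inl None); split=> //.
  rewrite affine_vf_ratio // !xpair_eqE !eqxx /= !(mul0r, mul1r, addr0, mulr0, subr0).
  by rewrite mulf_neq0 // ?invr_eq0 ?expf_neq0 // mulf_neq0.
have C e : xc k (~~ e) p = 0 ->
  exists e' b v w, [/\ cfac F v = cfac F w, v.1 = k, coord p w != 0 &
    affine_vf k e' b p (cratio v w) != 0].
  move=> x0; have be : bc k e p != 0.
    by apply/negP => /eqP be; apply: (nc e); apply/is_cornerP.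
  exists (~~ e), true, (k, inr (e, true)), (k, inr (e, false)).
  split=> //; rewrite affine_vf_ratio //.
  have ne : (inr (e, true) == inr (e, false) :> option bool + bool * bool) = false.
    by case: (e).
  rewrite !xpair_eqE !eqxx negbK !eqxx /= ne !(mul0r, mul1r, add0r, mulr0, subr0).
  by rewrite mulf_neq0 // ?invr_eq0 ?expf_neq0 // mulf_neq0.
have [x0|x0] := eqVneq (xc k true p) 0; first exact: (C false).
have [x1|x1] := eqVneq (xc k false p) 0; first exact: (C true).
exists true, false, (k, inl (Some true)), (k, inl (Some false)); split=> //.
rewrite affine_vf_ratio // !xpair_eqE !eqxx /= !(mul0r, mul1r, addr0, mulr0, subr0).
by rewrite mulf_neq0 // ?invr_eq0 ?expf_neq0 // mulf_neq0.
Qed.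

Lemma fields_vanish_corner p : fields_vanish p ->
  exists f : bool -> bool, forall k, is_corner k (f k) p.
Proof.
move=> H; suff C k : exists e, is_corner k e p by have [f fE] := choice C; exists f.
apply: contrapT => /forallNP/affine_vf_moves[e [b [v [w [vw _ pw /eqP]]]]]; apply.
by apply: H; [exact: affine_vf_vector_field|exact: regular_cratio].
Qed.

(** If neither component were a corner, a field moving the first and one moving the second would be
    independent. In the component opposite a corner, z = 0, as otherwise the two translations are
    independent; and z = 0 is the union of E_0, E_1 and L. *)
Lemma fields_rank_le1_curve p : fields_rank_le1 p ->
  exists k T e, on_curve k T p /\ is_corner (~~ k) e p.
Proof.
move=> H.
have [k [e ce]] : exists k e, is_corner k e p.
  apply: contrapT => N.
  have M k := @affine_vf_moves k p (fun e c => N (ex_intro _ k (ex_intro _ e c))).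
  have [e [b [v [w [vw vk pw n]]]]] := M false.
  have [e' [b' [v' [w' [vw' vk' pw' n']]]]] := M true.
  have := H _ _ _ _ (affine_vf_vector_field false e b) (affine_vf_vector_field true e' b')
    (regular_cratio vw pw) (regular_cratio vw' pw').
  rewrite [affine_vf false e b p (cratio v' w')]affine_vf_other ?vk' // mul0r => /eqP.
  by rewrite mulf_eq0 (negPf n) (negPf n').
exists (~~ k); rewrite negbK.
suff [T CT] : exists T, on_curve (~~ k) T p by exists T, e.
have [z0|z0] := eqVneq (zc (~~ k) p) 0.
  have h1 := blowup_rel (~~ k) true p; have h0 := blowup_rel (~~ k) false p.
  move/eqP: h1; move/eqP: h0; rewrite z0 !mul0r !mulf_eq0 /=.
  have [x1|x1 /= /eqP b0] := eqVneq (xc (~~ k) true p) 0; first by exists (Some false).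
  have [x0|x0 /= /eqP b1] := eqVneq (xc (~~ k) false p) 0; first by exists (Some true).
  by exists None.
have r e' : regular_at (cratio (~~ k, inl (Some e')) (~~ k, inl None)) p.
  exact: regular_cratio.
have := H _ _ _ _ (affine_vf_vector_field (~~ k) false true)
  (affine_vf_vector_field (~~ k) true true) (r false) (r true).
rewrite !affine_vf_ratio // !xpair_eqE !eqxx /= !(mul0r, mul1r, addr0, mulr0, subr0).
by rewrite -[X in X / _]expr2 divff ?expf_neq0 // mulr1 => /eqP; rewrite oner_eq0.
Qed.

End Fields.

(** * Counting zeros *)

Section Order7.
Variables (I : finType) (Y : Type) (z : I -> Y) (g : Y -> Y).
Hypothesis z_inj : injective z.
Hypothesis g7 : iter 7 g =1 id.
Hypothesis gz : forall i, exists j, g (z i) = z j.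

Lemma index_action : exists2 s : I -> I,
  (forall i, z (s i) = g (z i)) & injective s /\ iter 7 s =1 id.
Proof.
have [s sE] := choice gz; exists s => //.
have zi n i : z (iter n s i) = iter n g (z i) by elim: n => //= n <-; rewrite sE.
have s7 : iter 7 s =1 id by move=> i; apply: z_inj; rewrite zi g7.
split=> //; apply: (@can_inj _ _ _ (iter 6 s)) => i.
by rewrite -iterSr; apply: s7.
Qed.

(** A period n with 0 < n < 7 is coprime to 7, so by Bezout the periods n and 7 give the period
    1. *)
Lemma period_dvd7 (s : I -> I) i n : iter 7 s =1 id -> (0 < n < 7)%N ->
  iter n s i = i -> s i = i.
Proof.
move=> s7 /andP[n0 n7] sn.
have it m n' : iter n' s i = i -> iter (m * n') s i = i.
  by move=> e; elim: m => // m IH; rewrite mulSn iterD IH.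
have cop : gcdn n 7 = 1%N.
  by rewrite gcdnC; apply/eqP; rewrite -[_ == _]/(coprime 7 n) prime_coprime // gtnNdvd.
have [km kn e _] := egcdnP 7 n0.
have := it km _ sn; rewrite e cop addn1 iterS => e1.
by rewrite -[RHS]e1 it //; apply: s7.
Qed.

Lemma order7_fixes : (#|I| < 7)%N -> forall i, g (z i) = z i.
Proof.
move=> lt7 i; have [s sE [s_inj s7]] := index_action.
rewrite -sE (period_dvd7 (n := fingraph.order s i)) //; last exact: iter_order.
by rewrite fingraph.order_gt0 (leq_ltn_trans (max_card _)).
Qed.

(** Without a fixed point every orbit has exactly 7 elements, so 7 divides the number of labels. *)
Lemma order7_fixed : ~~ (7 %| #|I|)%N -> exists i, g (z i) = z i.
Proof.
move=> ndvd; have [s sE [s_inj s7]] := index_action.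
apply: contrapT => nofix; case/negP: ndvd; apply/dvdnP.
exists (fcard s I); rewrite -(@fcard_order_set _ _ s_inj 7 I) //.
apply/subsetP => i _; rewrite !inE; apply/eqP.
have on := iter_order s_inj i; have o0 := fingraph.order_gt0 s i.
case: (ltngtP (fingraph.order s i) 7) => // [lt7|gt7].
  case: nofix; exists i; rewrite -sE (period_dvd7 (n := fingraph.order s i)) //.
  by rewrite o0 lt7.
by have := findex_iter gt7; rewrite s7 findex0.
Qed.

End Order7.

(** * The loci singled out by global fields, and the zeros of s on the curves *)

Section Loci.
Variable F : closedFieldType.
Local Notation X := (dP7sq F).
Implicit Types (p q : X) (k e : bool) (T : option bool).

Lemma line_refl k T p : on_curve k T p -> in_line p T k p.
Proof. by move=> C; split=> //; apply: represents_half_coord. Qed.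

Lemma curve_chart k T p : on_curve k T p ->
  in_chart k (chart1 T) p \/ in_chart k (chart2 T) p.
Proof.
move=> C; have [ga1 [ga2 [_ h1 h2 h]]] := line_exists p T k.
have [[[t ->]|->] _] := h _ (line_refl C); first by left; case: (h1 t).
by right; case: (h2 0).
Qed.

(* The normal bundle of a (-1)-curve has no nonzero sections. *)
Lemma field_tangent v k T p : vector_field v -> on_curve k T p ->
  (in_chart k (chart1 T) p -> v p (normal T k (chart1 T)) = 0) /\
  (in_chart k (chart2 T) p -> v p (normal T k (chart2 T)) = 0).
Proof.
move=> Fv C; have [ga1 [ga2 [ell h1 h2 h]]] := line_exists p T k.
have [_ [c1 c2]] := h _ (line_refl C).
have tg := line_tangent ell Fv; split.
  by move=> /c1[t e]; rewrite [in v p]e; case: (tg t).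
by move=> /c2[t e]; rewrite [in v p]e; case: (tg t).
Qed.

Lemma corner_in_chart k e p : is_corner k e p -> in_chart k (e, true) p.
Proof.
move=> [E L]; have [x0 _ _] := on_exceptional E; have [_ a0 _] := on_line L.
by split; [|exact: a0].
Qed.

(** In this chart the first coordinate is normal to L and the second to E_e; tangency to both curves
    kills both. *)
Lemma field_corner v k e p : vector_field v -> is_corner k e p ->
  v p (fst_chart k (e, true)) = 0 /\ v p (snd_chart k (e, true)) = 0.
Proof.
move=> Fv c; have pc := corner_in_chart c; case: c => [E L].
have [h1 _] := field_tangent Fv E; have [g1 g2] := field_tangent Fv L.
split; last exact: h1.
by case: e pc {E h1} => pc; [exact: g2|exact: g1].
Qed.

Lemma corner_fields_vanish (f : bool -> bool) p :
  (forall k, is_corner k (f k) p) -> fields_vanish p.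
Proof.
move=> c v g Fv rg.
have pc k : in_chart k (f k, true) p by apply: corner_in_chart.
have [_ /(_ _ rg)[_ [a aE]]] := quadruple_spanned (Some true) true pc.
rewrite (aE _ (Fv.1 p)) big1 // => i _.
have [h1 h2] := field_corner Fv (c true); have [h3 h4] := field_corner Fv (c false).
by rewrite (quadruple_forall (A := fun h => v p h = 0)) ?mulr0.
Qed.

Definition curve_charts k (eb : bool * bool) e : bool -> bool * bool :=
  fun k' => if k' == k then eb else (e, true).

Lemma curve_charts_in k eb e p : in_chart k eb p -> is_corner (~~ k) e p ->
  forall k', in_chart k' (curve_charts k eb e k') p.
Proof.
move=> pc c k'; rewrite /curve_charts; case: eqVneq => [->//|ne].
by have -> : k' = ~~ k; [case: k' ne; case: (k)|exact: corner_in_chart].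
Qed.

Lemma curve_quadruple_spanned T k eb e p :
  in_chart k eb p -> is_corner (~~ k) e p ->
  let x := quadruple (tangential T k eb) (normal T k eb)
             (fst_chart (~~ k) (e, true)) (snd_chart (~~ k) (e, true)) in
  (forall i, regular_at (x i) p) /\ forall g, regular_at g p -> spanned p x g.
Proof.
move=> pc c; have := quadruple_spanned T k (curve_charts_in pc c).
by rewrite /curve_charts eqxx; have -> : (~~ k == k) = false by case: (k).
Qed.

(** Every field annihilates three of the four coordinates, the normal one and both at the corner;
    all values are thus multiples of the tangential one. *)
Lemma curve_fields_rank_le1 k T e p :
  on_curve k T p -> is_corner (~~ k) e p -> fields_rank_le1 p.
Proof.
move=> C c.
suff [eb pc nz] : exists2 eb, in_chart k eb p &
    forall v, vector_field v -> v p (normal T k eb) = 0.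
  have [_ sp] := curve_quadruple_spanned T pc c.
  have D g : regular_at g p ->
      exists a, forall w, vector_field w -> w p g = a * w p (tangential T k eb).
    move=> /sp[_ [a aE]]; exists (a ord0) => w Fw.
    rewrite (aE _ (Fw.1 p)) big_ord_recl big1 ?addr0 // => i _.
    have [h3 h4] := field_corner Fw c.
    by case: i => -[|[|[|]]] //= h; rewrite /quadruple /= ?h3 ?h4 ?nz // mulr0.
  move=> v w f g Fv Fw rf rg.
  have [a aE] := D f rf; have [b bE] := D g rg.
  by rewrite !aE // !bE //; ring.
have [pc|pc] := curve_chart C; [exists (chart1 T)|exists (chart2 T)] => //.
  by move=> v Fv; apply: (field_tangent Fv C).1.
by move=> v Fv; apply: (field_tangent Fv C).2.
Qed.

Lemma corner_uniq k e e' p : is_corner k e p -> is_corner k e' p -> e = e'.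
Proof.
move=> [E _] [[x0 _] _]; have [xe _ _] := on_exceptional E.
case: (eqVneq e e') => // ne; case/eqP: xe.
by have -> : e = ~~ e' by move: ne; case: (e); case: (e').
Qed.

Lemma half_corner k e p q :
  represents_half k (coord p) q -> is_corner k e p -> is_corner k e q.
Proof.
move=> [m [mu [_ _ E E']]] /is_cornerP[[x0 z0] b0]; apply/is_cornerP.
rewrite /on_curve /xc /zc /bc E E' E -/(xc _ _ _) -/(zc _ _) -/(bc _ _ _).
by rewrite x0 z0 b0 !mulr0.
Qed.

Lemma unique_zero (s : polyvector X 4) k T e :
  (forall (f : bool -> bool) p, (forall k, is_corner k (f k) p) -> ~ in_zero_locus s p) ->
  exists z, [/\ on_curve k T z, is_corner (~~ k) e z, in_zero_locus s z
    & forall q, on_curve k T q -> is_corner (~~ k) e q -> in_zero_locus s q -> q = z].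
Proof.
move=> nz; have [p0 /(_ (~~ k)) cp] := corner_exists F (fun=> e).
have [ga1 [ga2 [ell h1 h2 h]]] := line_exists p0 T k.
have inl q : in_line p0 T k q -> is_corner (~~ k) e q.
  by move=> [_ r]; apply: half_corner cp.
have c1 t : is_corner (~~ k) e (ga1 t) by apply: inl; case: (h1 t).
have c2 t : is_corner (~~ k) e (ga2 t) by apply: inl; case: (h2 t).
have sp1 t := curve_quadruple_spanned T (h1 t).2 (c1 t).
have sp2 t := curve_quadruple_spanned T (h2 t).2 (c2 t).
have rf t : regular_at (fst_chart (~~ k) (e, true)) (ga1 t) /\
            regular_at (fst_chart (~~ k) (e, true)) (ga2 t).
  by split; apply: regular_fst_chart; apply: corner_in_chart.
have rg t : regular_at (snd_chart (~~ k) (e, true)) (ga1 t) /\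
            regular_at (snd_chart (~~ k) (e, true)) (ga2 t).
  by split; apply: regular_snd_chart; apply: corner_in_chart.
have [a [b E]] := line_anticanonical ell s rf rg.
have Z1 t : in_zero_locus s (ga1 t) <-> a + b * t = 0.
  have [r sp] := sp1 t; rewrite -(E t).1; split=> [zl|]; first exact: zl.
  exact: in_zero_locus_spanned.
have Z2 t : in_zero_locus s (ga2 t) <-> a * t + b = 0.
  have [r sp] := sp2 t; split=> [zl|ab].
    by apply/eqP; rewrite -oppr_eq0 -(E t).2; apply/eqP/zl.
  by apply: (in_zero_locus_spanned sp r); rewrite (E t).2 ab oppr0.
(* The parameter 0 is a corner: on E_e it means b_e = 0, and on L it means y = 0, the corner on
   E_0. *)
have [e0 ce0] : exists e0, is_corner k e0 (ga1 0).
  have [[C _] pc] := h1 0; have tau0 := line_tau1E ell 0.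
  have := proj2 pc; move: pc C tau0; rewrite /tangential /fst_chart /snd_chart.
  case: (T) => [e1|] /= [x0 _] C; rewrite cratioE => /eqP; rewrite mulf_eq0 invr_eq0.
    by move=> /orP[/eqP b0 _|/eqP-> /eqP//]; exists e1; apply/is_cornerP.
  have [z0 _ _] := on_line C.
  by rewrite (negPf x0) orbF => /eqP x1 _; exists false; split.
(* The value of the section at that corner is [a], so [a + b * t] is not identically 0. Its only
   zero is - a / b, or the point at infinity [ga2 0] if [b = 0]. *)
have a0 : a != 0.
  apply/eqP => a0; apply: (nz (fun k' => if k' == k then e0 else e) (ga1 0)).
    move=> k'; case: (eqVneq k' k) => [->//|ne].
    by have -> : k' = ~~ k by case: k' ne; case: (k).
  by apply/Z1; rewrite a0 mulr0 addr0.
have cover q : on_curve k T q -> is_corner (~~ k) e q ->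
    (exists t, q = ga1 t) \/ q = ga2 0.
  move=> C c; have [] // := h q; split=> //; exact: corner_half c cp.
have [b0|b0] := eqVneq b 0.
  exists (ga2 0); split; [exact: (h2 0).1.1|exact: c2| |].
    by apply/Z2; rewrite mulr0 add0r.
  move=> q C c; have [[t ->]|//] := cover q C c.
  by move/Z1/eqP; rewrite b0 mul0r addr0 (negPf a0).
exists (ga1 (- a / b)); split; [exact: (h1 _).1.1|exact: c1| |].
  by apply/Z1; rewrite mulrCA divff // mulr1 subrr.
move=> q C c; have [[t ->]|->] := cover q C c.
  move/Z1 => ab; congr ga1; apply: (mulfI b0); rewrite mulrCA divff // mulr1.
  by apply/eqP; rewrite -addr_eq0 addrC ab.
by move/Z2/eqP; rewrite mulr0 add0r (negPf b0).
Qed.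

Theorem no_free_anticanonical_section (g : automorphism X) (s : polyvector X 4) a :
  has_order g 7 -> semi_invariant g s a ->
  exists p, in_zero_locus s p /\ in_fixed_locus g p.
Proof.
move=> [_ g7 gmin] inv; apply: contrapT => N.
have fixN p : g p = p -> ~ in_zero_locus s p.
  move=> gp zp; apply: N; exists p; split=> //; exists 1%N; split=> //.
  exact: gmin.
have nz (f : bool -> bool) p : (forall k, is_corner k (f k) p) -> ~ in_zero_locus s p.
  pose fn (i : bool * bool) k := if k then i.2 else i.1.
  have [z zE] := choice (fun i => corner_exists F (fn i)).
  have surj q (h : bool -> bool) : (forall k, is_corner k (h k) q) -> q = z (h false, h true).
    by move=> hq; apply: (corner_eq hq) => k; have := zE (h false, h true) k; case: k.
  move=> /surj->; apply: fixN; apply: (order7_fixes (z := z)) => //; last first.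
  - by rewrite card_prod card_bool.
  - move=> i; have [h hE] : exists h : bool -> bool, forall k, is_corner k (h k) (g (z i)).
      exact/fields_vanish_corner/fields_vanish_aut/corner_fields_vanish/(zE i).
    by exists (h false, h true); apply: surj.
  move=> [i1 i2] [j1 j2] e.
  have ci := zE (i1, i2); have cj := zE (j1, j2); rewrite -e in cj.
  congr pair; [exact: corner_uniq (ci false) (cj false)|].
  exact: corner_uniq (ci true) (cj true).
pose I := (bool * option bool * bool)%type.
have [z zE] := choice (fun i : I => unique_zero i.1.1 i.1.2 i.2 nz).
have nocorner k e e' p : in_zero_locus s p -> is_corner k e p ->
    is_corner (~~ k) e' p -> False.
  move=> zp ck ck'; apply: (nz (fun k' => if k' == k then e else e') p) => // k'.
  case: (eqVneq k' k) => [->//|ne].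
  by have -> : k' = ~~ k by case: k' ne; case: (k).
have [] := @order7_fixed I _ z g _ g7.
(* Distinct labels give distinct zeros: a common zero for different [k], or for L and some E_e,
   would be a corner in both copies, while E_0 and E_1 are disjoint. *)
- move=> [[k T] e] [[k' T'] e'] E; have [C c zp _] := zE (k, T, e).
  have [C' c' _ _] := zE (k', T', e'); rewrite -{}E /= in C' c'.
  have [ek|ne] := eqVneq k' k; last first.
    have ek : k' = ~~ k by case: k' ne {C' c'}; case: (k).
    rewrite ek negbK in c'; by case: (nocorner _ _ _ _ zp c' c).
  subst k'; have ee : e = e' := corner_uniq c c'.
  rewrite -ee; congr (_, _, _).
  have LE e1 : on_curve k None (z (k, T, e)) -> on_curve k (Some e1) (z (k, T, e)) -> False.
    by move=> L E; apply: (nocorner k e1 e _ zp).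
  case: T T' C C' {c c' zp} LE => [e1|] [e2|] C C' LE //.
  + congr Some; apply: contrapT => ne; have [x0 _ _] := on_exceptional C.
    case/eqP: x0; have [<- _] := C'; congr (xc k _ _).
    by case: (e1) ne; case: (e2).
  + by case: (LE e1).
  + by case: (LE e2).
(* The image has field rank at most 1, so it lies on one of the twelve curves; being a zero of s, it
   is the unique zero there. *)
- move=> [[k T] e]; have [C c zp _] := zE (k, T, e).
  have [k' [T' [e' [C' c']]]] := fields_rank_le1_curve
    (@fields_rank_le1_aut _ _ g _ (curve_fields_rank_le1 C c)).
  exists (k', T', e'); have [_ _ _ uq] := zE (k', T', e').
  have zp' := in_zero_locus_aut inv zp.
  exact: uq _ C' c' zp'.
- by rewrite !card_prod card_option card_bool.
move=> i gi; have [_ _ zp _] := zE i.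
exact: fixN gi zp.
Qed.

End Loci.

Theorem mainTheorem7 (R : realType) :
  ~ exists (g : automorphism (dP7xdP7 R)) (s : anticanonical_section R),
      [/\ has_order g 7,
          exists c : R[i], c != 0 /\ semi_invariant g s c
        & forall p : dP7xdP7 R, in_zero_locus s p -> ~ in_fixed_locus g p].
Proof.
move=> [g [s [g7 [c [_ inv]] free]]].
have [p [zp fp]] := no_free_anticanonical_section (F := R[i]) g7 inv.
exact: free zp fp.
Qed.
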